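(* Let $R$ be a finite set of primes with cardinality $w$ and let $W$ be the infinite set of all positive integers not divisible by any primes not in $R$. Let $c$ be any positive odd integer none of whose prime divisors is in $R$. Then there are at most $3^{w-1} + 2^{w-1}$ solutions $(A,B,z)$ to the equation $$A + B = c^z,$$ where $A, B$ are integers with $AB \in W$, $A < B$, and $z$ is a positive integer. *)

(* Defs.v *)
From mathcomp Require Import all_boot all_order all_algebra.
From mathcomp Require Import finmap.
From mathcomp Require Import boolp classical_sets cardinality.

Set Implicit Arguments.
Unset Strict Implicit.
Unset Printing Implicit Defensive.

Import Order.TTheory GRing.Theory Num.Theory.

Local Open Scope classical_set_scope.
Local Open Scope ring_scope.

(* W as a subset of int, since it is tested on products A * B with A and B of
   arbitrary sign. *)
Definition supported_on (R : {fset nat}) : set int :=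
  [set n | 0 < n /\ forall p : nat, prime p -> p \notin R -> ~~ (p %| n)%Z].

Definition solutions (R : {fset nat}) (c : nat) : set (int * int * nat) :=
  [set t | let: (A, B, z) := t in
     [/\ supported_on R (A * B), A < B, (0 < z)%N & A + B = (c ^ z)%N%:Z]].

(* Main.v *)
Require Import Defs.
From mathcomp Require Import all_boot all_order all_algebra.
From mathcomp Require Import cyclic.
From mathcomp Require Import finmap.
From mathcomp Require Import boolp classical_sets cardinality.
From mathcomp Require Import zify ring.

(** The number c is odd and coprime to R, so in a solution exactly one of A, B is
    even, and A, B are coprime.  A solution is written (a, b, z) with a even, and
    solutions are grouped by the set U of primes dividing ab, which contains 2.
    With n = |U|, each group has at most 2^(n-1) + 1 elements (solutions_size), and
    the sum over all sets U is 3^(w-1) + 2^(w-1) (sum_expn_card).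

    Counting.  The ratio a/b is a unit at the primes outside U and equals -1 modulo
    c.  Let Lambda be the lattice of exponent vectors v for which the product of the
    p^(v_p), p in U, is 1 or -1 modulo c.  Then Lambda / 2 Lambda has 2^n elements,
    half of which come from vectors with value -1.  So more than 2^(n-1) solutions
    would contain two whose vectors differ by an element of 2 Lambda; such solutions
    are called related (solutions_card).

    Related solutions.  Let (a, b, z) and (a', b', z') be related, with z <= z'.  Then
    D = gcd(ab, a'b') divides ab and a'b' with square quotients, so that
    (sqrt b + sqrt (-a))^2 = b - a + 2u sqrt (-D), and likewise for the other
    solution.  These elements have norms c^(2z) and c^(2z').  The congruence in the
    definition of related solutions says that, up to conjugation, they generate
    powers of one and the same ideal of norm c^2; here lies the point of Lambda, as
    c may have many prime factors.  Division with remainder of the exponents then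
    shows that both are powers of one element, so that z = z' forces equality and
    otherwise the second element is delta^r for a prime r (qrep_prime_root), where
    delta = (sqrt B + sqrt (-A))^2 and A + B is a power of c.  Every prime of U
    divides D, hence AB, and this leaves very few primes for the cofactors a'/A and
    b'/B.  If r = 2, then |B - A| = 1 and the solution is (4AB, 1).  If r is odd, the
    cofactors are powers of r; their size excludes r > 3, and r = 3 leads to
    {A, B} = {m, 3m + 1} with 8m + 3 a power of 3 (related_special).

    The exceptional solutions.  A given U admits at most one solution of these two
    special kinds (special_unique), since the sets of primes dividing
    c^(2j) - 1, or m (3m + 1) with 24m + 8 = 9^(a+1) - 1, determine j, respectively
    m, and are never the same.  This follows from a weak form of Zsigmondy's theorem
    (expn_subr1_support).  Removing the special solution leaves pairwise unrelated
    solutions, at most 2^(n-1) in number. *)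

Import Order.TTheory GRing.Theory Num.Theory.

Local Open Scope classical_set_scope.
Local Open Scope ring_scope.

(** * Numbers of the form b^n - 1 and their prime divisors *)

Lemma dvdn_natF (p n : nat) : prime p -> (p %| n)%N = (n%:R == 0 :> 'F_p).
Proof. by move=> p_pr; rewrite (dvdn_pcharf (pchar_Fp p_pr)). Qed.

Lemma dvdn_expB1 (p x n : nat) : prime p -> (0 < x)%N ->
  (p %| x ^ n - 1)%N = (x%:R ^+ n == 1 :> 'F_p).
Proof.
move=> p_pr x_gt0; rewrite dvdn_natF // natrB ?expn_gt0 ?x_gt0 //.
by rewrite subr_eq0 natrX.
Qed.

Lemma expr_gcdn_eq1 (A : pzRingType) (x : A) (m n : nat) :
  (0 < m)%N -> x ^+ m = 1 -> x ^+ n = 1 -> x ^+ gcdn m n = 1.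
Proof.
move=> m_gt0 xm xn; case: (egcdnP n m_gt0) => u v uv _.
have: x ^+ (u * m) = 1 by rewrite mulnC exprM xm expr1n.
by rewrite uv exprD mulnC exprM xn expr1n mul1r.
Qed.

Lemma only_prime_divisor (r n : nat) : (0 < n)%N ->
  (forall p, prime p -> (p %| n)%N -> p = r) -> exists k, n = (r ^ k)%N.
Proof.
move=> n_gt0 only.
have: r.-nat n by apply/pnatP => // p p_pr pn; rewrite (only p p_pr pn) inE.
by case/p_natP => k ->; exists k.
Qed.

Lemma odd_prime_divisor (n : nat) : odd n -> (1 < n)%N ->
  exists p, [/\ prime p, odd p & (p %| n)%N].
Proof.
move=> n_odd n_gt1; exists (pdiv n); split; rewrite ?pdiv_prime ?pdiv_dvd //.
exact: dvdn_odd (pdiv_dvd n) n_odd.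
Qed.

(** With b = 1 + hr, the sum is r + hr * r(r-1)/2 modulo r^2, and (r-1)/2 is an
    integer for odd r: this is the exact-exponent part of the lifting lemma. *)
Lemma geom_sum_mod_sq (r b : nat) : odd r -> (r %| b - 1)%N -> (0 < b)%N ->
  (\sum_(i < r) b ^ i = r %[mod r ^ 2])%N.
Proof.
move=> r_odd /dvdnP[h bE] b_gt0.
have {bE} ->: b = (1 + h * r)%N by lia.
have step i : ((1 + h * r) ^ i = 1 + i * (h * r) %[mod r ^ 2])%N.
  elim: i => [|i IH]; first by rewrite mul0n.
  rewrite expnS -modnMmr IH modnMmr.
  have -> : ((1 + h * r) * (1 + i * (h * r)) =
     i * h ^ 2 * r ^ 2 + (1 + i.+1 * (h * r)))%N by ring.
  by rewrite modnMDl.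
rewrite -modn_summ (eq_bigr _ (fun (i : 'I_r) _ => step i)) modn_summ.
rewrite big_split /= sum1_card card_ord -big_distrl /=.
rewrite -(big_mkord xpredT (fun i => i)) bin2_sum bin2odd //.
have -> : (r + r * r.-1./2 * (h * r) = r.-1./2 * h * r ^ 2 + r)%N by ring.
by rewrite modnMDl.
Qed.

Lemma geom_sum_expn (b r : nat) : (0 < b)%N ->
  (b ^ r - 1 = (b - 1) * \sum_(i < r) b ^ i)%N.
Proof. by move=> b_gt0; rewrite !subn1 predn_exp. Qed.

Lemma geom_sum_gt (b r : nat) : (1 < b)%N -> (1 < r)%N ->
  (r < \sum_(i < r) b ^ i)%N.
Proof.
move=> b_gt1; case: r => [|[|r]] // _; elim: r => [|r IH].
  by rewrite !big_ord_recr big_ord0 /= expn0 expn1; lia.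
rewrite big_ord_recr /= -[X in (X <= _)%N]addn1 leq_add //.
by rewrite expn_gt0 (ltnW b_gt1).
Qed.

(** A weak form of Zsigmondy's theorem.  If n does not divide m, put
    d = gcd(n, m), B = b^d and let r be a prime divisor of n/d.  A prime dividing
    Q = 1 + B + ... + B^(r-1) divides b^n - 1, hence b^m - 1, hence B - 1, hence
    Q = r modulo it; so Q is a power of r.  But r^2 does not divide Q (for r = 2
    because b = 1 mod 4), so Q <= r, which is absurd. *)
Lemma expn_subr1_support (b n m : nat) : (1 < b)%N -> (b %% 4 = 1)%N ->
  (0 < n)%N -> (0 < m)%N ->
  (forall p, prime p -> (p %| b ^ n - 1)%N -> (p %| b ^ m - 1)%N) ->
  (n %| m)%N.
Proof.
move=> b_gt1 b_mod4 n_gt0 m_gt0 supp.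
have b_gt0 : (0 < b)%N by lia.
have d_gt0 : (0 < gcdn n m)%N by rewrite gcdn_gt0 n_gt0.
have /dvdnP[j nE] := dvdn_gcdl n m.
have [j_le1|j_gt1] := leqP j 1.
  have j1 : j = 1%N by nia.
  by rewrite nE j1 mul1n dvdn_gcdr.
pose r := pdiv j; pose B := (b ^ gcdn n m)%N.
have r_pr : prime r by apply: pdiv_prime.
have /dvdnP[q jE] : (r %| j)%N by apply: pdiv_dvd.
have B_gt1 : (1 < B)%N by rewrite /B -(exp1n (gcdn n m)) ltn_exp2r.
have B_mod4 : (B %% 4 = 1)%N by rewrite /B -modnXm b_mod4 exp1n.
pose Q := (\sum_(i < r) B ^ i)%N.
have Q_gt : (r < Q)%N by apply: geom_sum_gt => //; apply: prime_gt1.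
have Q_dvd : (Q %| b ^ n - 1)%N.
  have -> : (b ^ n = (B ^ r) ^ q)%N by rewrite /B -!expnM; congr (_ ^ _)%N; lia.
  apply: (@dvdn_trans (B ^ r - 1)); first by rewrite geom_sum_expn ?dvdn_mull //; lia.
  by rewrite (geom_sum_expn (B ^ r)) ?expn_gt0 ?dvdn_mulr //; lia.
have rB p : prime p -> (p %| Q)%N -> p = r /\ (r %| B - 1)%N.
  move=> p_pr pQ; have pn := dvdn_trans pQ Q_dvd.
  have pm := supp p p_pr pn.
  have pB : (p %| B - 1)%N.
    rewrite -[B]expn1 dvdn_expB1 //; last by lia.
    rewrite expr1 natrX; apply/eqP; apply: expr_gcdn_eq1 => //; apply/eqP.
      by rewrite -dvdn_expB1.
    by rewrite -dvdn_expB1.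
  suff pr : p = r by split=> //; rewrite -pr.
  apply/eqP; rewrite -dvdn_prime2 //; move: pQ.
  rewrite !dvdn_natF // /Q natr_sum (eq_bigr (fun=> 1)).
    by rewrite sumr_const card_ord.
  move=> i _; apply/eqP; rewrite natrX.
  by move: pB; rewrite -[B]expn1 dvdn_expB1 // ?expr1; [move/eqP->; rewrite expr1n|lia].
have [k QE] : exists k, Q = (r ^ k)%N.
  by apply: only_prime_divisor; [lia|move=> p p_pr /(rB p p_pr)[]].
have rr_Q : (r ^ 2 %| Q)%N.
  move: Q_gt; rewrite QE; case: k {QE} => [|[|k]] //.
  - by have := prime_gt1 r_pr; lia.
  - by rewrite expn1 ltnn.
  - by move=> _; rewrite dvdn_exp2l.
have r_Q : (r %| Q)%N by apply: dvdn_trans rr_Q; rewrite dvdn_exp.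
have [_ r_B] := rB r r_pr r_Q.
case: (even_prime r_pr) => [r2|r_odd].
  move: rr_Q; rewrite /Q r2 !big_ord_recl big_ord0 /= expn0 expn1 addn0.
  by rewrite /dvdn -modnDmr B_mod4.
have := geom_sum_mod_sq r B r_odd r_B (ltnW B_gt1).
move/eqP: rr_Q => -> /esym/eqP; rewrite -/(dvdn _ _) => /dvdn_leq.
by have := prime_gt1 r_pr; nia.
Qed.

(** The residues 4 and 7 say that 3 divides b - 1 exactly once; each further
    factor 3 of b^n - 1 then has to come from a factor 3 of the exponent, since
    b^(2n') + b^n' + 1 is 3 modulo 9. *)
Lemma expn_subr1_mod3 (b n j : nat) : (b %% 9 \in [:: 4; 7])%N ->
  (3 ^ j.+1 %| b ^ n - 1)%N -> (3 ^ j %| n)%N.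
Proof.
elim: j n => [|j IH] n b_mod9 dvd; first exact: dvd1n.
have b_gt0 : (0 < b)%N by move: b_mod9; case: b {dvd IH}.
have: (b ^ n %% 9 = 1)%N.
  have: (3 ^ 2 %| b ^ n - 1)%N by apply: dvdn_trans dvd; rewrite dvdn_exp2l.
  have: (0 < b ^ n)%N by rewrite expn_gt0 b_gt0.
  by lia.
have nE := divn_eq n 3.
have: (b ^ 3 %% 9 = 1)%N.
  by rewrite -modnXm; move: b_mod9; rewrite !inE => /orP[]/eqP->.
move=> b3; rewrite {1}nE expnD [(_ * 3)%N]mulnC expnM -modnMml -modnXm b3 exp1n.
rewrite modnMml mul1n -modnXm => bn.
have n3 : (n %% 3 = 0)%N.
  have := ltn_pmod n (isT : (0 < 3)%N).
  by move: b_mod9 bn; rewrite !inE; case: (n %% 3)%N => [|[|[|]]] // /orP[]/eqP->.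
have {}nE : (n = n %/ 3 * 3)%N by lia.
rewrite nE expnSr dvdn_pmul2r //; apply: IH => //.
move: dvd; rewrite {1}nE expnM; set X := (b ^ _)%N.
have X3 : (X %% 3 = 1)%N.
  rewrite /X -modnXm; have -> : (b %% 3 = 1)%N by move: b_mod9; rewrite !inE; lia.
  by rewrite exp1n.
have -> : (X ^ 3 - 1 = (X - 1) * (X ^ 2 + X + 1))%N by nia.
have [y yE] : exists y, X = (3 * y + 1)%N by exists (X %/ 3)%N; lia.
have -> : (X ^ 2 + X + 1 = 3 * (3 * (y ^ 2 + y) + 1))%N by rewrite yE; ring.
rewrite mulnCA [(3 ^ j.+2)%N]expnS dvdn_pmul2l // Gauss_dvdl //.
by apply: coprimeXl; rewrite prime_coprime //; lia.
Qed.

(** * Incompatibility of the exceptional families *)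

Lemma sqrn_mod4 (n : nat) : odd n -> (n ^ 2 %% 4 = 1)%N.
Proof.
by move=> n_odd; rewrite -modnXm; have [->|->] : (n %% 4 = 1 \/ n %% 4 = 3)%N by lia.
Qed.

Lemma odd_expn_mod4 (n k : nat) : odd n -> odd k -> (n ^ k = n %[mod 4])%N.
Proof.
move=> n_odd k_odd; rewrite -(odd_double_half k) k_odd -mul2n expnS expnM.
by rewrite -modnMmr -modnXm sqrn_mod4 // exp1n muln1.
Qed.
(** As C = 1 mod 4, C + 1 has an odd prime divisor p.  It divides C^l - 1, yet
    C^k = -1 mod p makes p divide 4m + 2, which is coprime to m and to 3m + 1
    away from 2. *)
Lemma even_exponent_absurd (C k l m : nat) : odd C -> (1 < C)%N -> odd k ->
  ~~ odd l -> (C ^ k = 4 * m + 1)%N ->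
  (forall p, prime p -> odd p -> (p %| C ^ l - 1)%N -> (p %| m * (3 * m + 1))%N) ->
  False.
Proof.
move=> C_odd C_gt1 k_odd l_even CkE supp.
have C_mod4 : (C %% 4 = 1)%N.
  by have := odd_expn_mod4 C k C_odd k_odd; rewrite CkE; lia.
have [p [p_pr p_odd pC]] := @odd_prime_divisor (C %/ 2 + 1) ltac:(lia) ltac:(lia).
have pC1 : (C%:R : 'F_p) = -1.
  apply/eqP; rewrite -addr_eq0 natr1 -dvdn_natF //.
  by apply: dvdn_trans pC _; apply/dvdnP; exists 2; lia.
have p_gt2 := odd_prime_gt2 p_odd p_pr.
have p2 : (p %| 2)%N = false by rewrite dvdn_prime2 //; lia.
have := supp p p_pr p_odd; rewrite dvdn_expB1 ?(ltnW C_gt1) //.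
rewrite pC1 -signr_odd (negbTE l_even) eqxx => /(_ isT).
have pm : (p %| 4 * m + 2)%N.
  rewrite dvdn_natF // (_ : 4 * m + 2 = (C ^ k).+1)%N; last by lia.
  by rewrite -natr1 natrX pC1 -signr_odd k_odd addNr.
rewrite Euclid_dvdM // => /orP[pm'|pm'].
  by move: pm; rewrite dvdn_addr ?dvdn_mull // p2.
have : (p %| 3 * (4 * m + 2))%N by rewrite dvdn_mull.
rewrite (_ : 3 * (4 * m + 2) = 4 * (3 * m + 1) + 2)%N; last by lia.
by rewrite dvdn_addr ?dvdn_mull // p2.
Qed.

(** Rewrites 3^e = 8m + 3 in the forms used below: e = 2a + 1 is odd by reduction
    modulo 8, so 8(3m + 1) = 9^(a+1) - 1, and 3 divides m exactly once. *)
Lemma pow3_form (m e : nat) : (0 < m)%N -> (3 ^ e = 8 * m + 3)%N ->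
  exists a, [/\ (0 < a)%N, e = (2 * a + 1)%N, ((3 ^ 2) ^ a.+1 - 1 = 8 * (3 * m + 1))%N
             & (m %% 9 \in [:: 3; 6])%N].
Proof.
move=> m_gt0 eE.
have sq n : (9 ^ n %% 8 = 1)%N by rewrite -modnXm exp1n.
have half n : (3 ^ (n * 2) = 9 ^ n)%N by rewrite mulnC expnM.
have e_odd : odd e.
  apply: contraT => e_even; move: (sq e./2).
  have eh : e = (e./2 * 2)%N by lia.
  by rewrite -half -eh eE; lia.
have eh : e = (e./2 * 2 + 1)%N by lia.
have E : (3 * 9 ^ e./2 = 8 * m + 3)%N by rewrite -half -expnS -eE; congr (_ ^ _)%N; lia.
exists e./2; split; try lia.
- by case: (e./2) E => [|//]; rewrite expn0; lia.
- by rewrite (_ : 3 ^ 2 = 9)%N // expnS; lia.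
- move: E; case: (e./2) => [|n]; first by rewrite expn0; lia.
  by rewrite expnS !inE; lia.
Qed.

(** Let g = gcd(2j, k), C = c^g, l = 2j/g.  By the previous parity lemma l is odd.
    A prime p dividing 3m + 1 divides C^l - 1 while 3 c^k = -1 mod p, so that
    3^l = -1 mod p.  Hence all primes of 9^(a+1) - 1 = 8(3m + 1) divide 9^l - 1,
    and a + 1 divides l.  Then a + 1 is odd, so (3^(a+1) - 1)/2 has an odd prime
    divisor p; it divides 3m + 1, and 3^l is both 1 and -1 mod p. *)
Lemma special_types_disjoint (c j k m e : nat) : odd c -> (1 < c)%N -> (0 < j)%N ->
  (0 < m)%N -> (c ^ k = 4 * m + 1)%N -> (3 ^ e = 8 * m + 3)%N ->
  (forall p, prime p -> (p %| c ^ (2 * j) - 1)%N = (p %| m * (3 * m + 1))%N) ->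
  False.
Proof.
move=> c_odd c_gt1 j_gt0 m_gt0 ckE eE supp.
have [a [a_gt0 _ aE _]] := pow3_form m e m_gt0 eE.
have k_gt0 : (0 < k)%N by case: k ckE => // ; rewrite expn0; lia.
pose g := gcdn (2 * j) k; pose C := (c ^ g)%N.
have g_gt0 : (0 < g)%N by rewrite gcdn_gt0 k_gt0 orbT.
have /dvdnP[l lE] : (g %| 2 * j)%N by apply: dvdn_gcdl.
have /dvdnP[q qE] : (g %| k)%N by apply: dvdn_gcdr.
have co : coprime l q.
  by rewrite /coprime -(eqn_pmul2r g_gt0) muln_gcdl -lE -qE mul1n.
have C_gt1 : (1 < C)%N by rewrite /C -(exp1n g) ltn_exp2r.
have C_odd : odd C by rewrite /C oddX c_odd orbT.
have ClE : (c ^ (2 * j) = C ^ l)%N by rewrite /C -expnM lE mulnC.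
have CqE : (C ^ q = 4 * m + 1)%N by rewrite /C -expnM -ckE qE mulnC.
clearbody C; rewrite {}ClE in supp.
case: (boolP (odd l)) => [l_odd|l_even]; last first.
  apply: (@even_exponent_absurd C q l m) => //.
    by apply: contraLR co; rewrite -!dvdn2 => q_even; apply/negP => /eqP;
      apply/eqP; rewrite neq_ltn; apply/orP; right;
      apply: (@leq_trans 2) => //; apply: dvdn_leq; rewrite ?gcdn_gt0 ?dvdn_gcd; lia.
  by move=> p p_pr _; rewrite supp.
have C_gt0 : (0 < C)%N by lia.
have key p : prime p -> (p %| 3 * m + 1)%N -> (3 : 'F_p) ^+ l = -1.
  move=> p_pr pB.
  have : (p %| C ^ l - 1)%N by rewrite supp // dvdn_mull.
  rewrite dvdn_expB1 // => /eqP Cl.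
  have E : (3 : 'F_p) * C%:R ^+ q = -1.
    apply/eqP; rewrite -addr_eq0 -natrX CqE -natrM natr1 -dvdn_natF //.
    rewrite (_ : (3 * (4 * m + 1)).+1 = 4 * (3 * m + 1))%N; last by lia.
    by rewrite dvdn_mull.
  have := congr1 (fun x => x ^+ l) E.
  by rewrite exprMn exprAC Cl expr1n mulr1 -signr_odd l_odd.
have a_l : (a.+1 %| l)%N.
  apply: (@expn_subr1_support (3 ^ 2)) => //; first by lia.
  move=> p p_pr; rewrite aE Euclid_dvdM // => /orP[p8|/(key p p_pr) p3].
    move: p8; rewrite (_ : 8 = 2 ^ 3)%N // Euclid_dvdX // andbT dvdn_prime2 //.
    by move/eqP->; rewrite dvdn2 oddB ?expn_gt0 // oddX orbT.
  by rewrite dvdn_expB1 // natrX exprAC p3 sqrrN expr1n.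
have /dvdnP[h hE] := a_l.
have [h_odd a_odd] : odd h /\ odd a.+1 by move: l_odd; rewrite hE oddM => /andP[].
pose N := (3 ^ a.+1)%N.
have N2 : ((3 ^ 2) ^ a.+1 = N ^ 2)%N by rewrite /N expnAC.
have N_gt : (8 < N)%N by rewrite /N (@leq_trans (3 ^ 2)) // leq_exp2l.
have N_mod : (N %% 4 = 3)%N.
  rewrite /N -(odd_double_half a.+1) a_odd expnS -mul2n expnM.
  by rewrite -modnMmr -modnXm exp1n.
have [p [p_pr p_odd pN]] := @odd_prime_divisor (N %/ 2) ltac:(lia) ltac:(lia).
have {}pN : (p %| N - 1)%N.
  by apply: dvdn_trans pN _; apply/dvdnP; exists 2; lia.
have p_gt2 := odd_prime_gt2 p_odd p_pr.
have p2 : (p %| 2)%N = false by rewrite dvdn_prime2 //; lia.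
have pB : (p %| 3 * m + 1)%N.
  have : (p %| 8 * (3 * m + 1))%N.
    by rewrite -aE N2 -[X in (_ - X)%N](exp1n 2) subn_sqr dvdn_mulr.
  by rewrite Euclid_dvdM // (_ : 8 = 2 ^ 3)%N // Euclid_dvdX // p2.
have := key p p_pr pB; rewrite hE mulnC exprM.
have -> : (3 : 'F_p) ^+ a.+1 = 1 by apply/eqP; rewrite -dvdn_expB1.
rewrite expr1n => /eqP; rewrite -subr_eq0 opprK -(natrD _ 1 1) -dvdn_natF //.
by rewrite p2.
Qed.

(** Let g = gcd(k, k'), C = c^g, q = k/g and l = k'/g, and write 3^e = 3 * 9^a.
    Modulo a prime p of C^l - 1 = 4m', either C = 1 or 9 C^(2q) = 9^(a+1) = 1.
    In both cases C^h = 1 for h = gcd(l, a + 1), so l divides h and l <= a + 1.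
    On the other hand 3^e divides C^(l-q) - 1 while 3 divides C - 1 only once, so
    9^a divides l - q: this is too large. *)
Lemma special_cubes_unique (c k k' m m' e e' : nat) : odd c -> (1 < c)%N ->
  (0 < m)%N -> (0 < m')%N -> (k < k')%N ->
  (c ^ k = 4 * m + 1)%N -> (3 ^ e = 8 * m + 3)%N ->
  (c ^ k' = 4 * m' + 1)%N -> (3 ^ e' = 8 * m' + 3)%N ->
  (forall p, prime p -> (p %| m' * (3 * m' + 1))%N -> (p %| m * (3 * m + 1))%N) ->
  False.
Proof.
move=> c_odd c_gt1 m_gt0 m'_gt0 k_lt ckE eE ck'E e'E supp.
have [a [a_gt0 eaE aE m_mod9]] := pow3_form m e m_gt0 eE.
have [a' [_ _ _ m'_mod9]] := pow3_form m' e' m'_gt0 e'E.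
have k_gt0 : (0 < k)%N by case: k ckE {k_lt} => // ; rewrite expn0; lia.
pose g := gcdn k k'; pose C := (c ^ g)%N.
have g_gt0 : (0 < g)%N by rewrite gcdn_gt0 k_gt0.
have /dvdnP[q qE] : (g %| k)%N by apply: dvdn_gcdl.
have /dvdnP[l lE] : (g %| k')%N by apply: dvdn_gcdr.
have co : coprime q l.
  by rewrite /coprime -(eqn_pmul2r g_gt0) muln_gcdl -lE -qE mul1n.
have C_gt1 : (1 < C)%N by rewrite /C -(exp1n g) ltn_exp2r.
have C_odd : odd C by rewrite /C oddX c_odd orbT.
have ClE : (C ^ l = 4 * m' + 1)%N by rewrite /C -expnM -ck'E lE mulnC.
have CqE : (C ^ q = 4 * m + 1)%N by rewrite /C -expnM -ckE qE mulnC.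
have q_lt : (q < l)%N by rewrite -(ltn_pmul2r g_gt0) -qE -lE.
have q_gt0 : (0 < q)%N by case: q CqE {qE co q_lt}=> //; rewrite expn0; lia.
clearbody C.
have C_gt0 : (0 < C)%N by lia.
have suppC p : prime p -> odd p -> (p %| C ^ l - 1)%N -> (p %| m * (3 * m + 1))%N.
  move=> p_pr p_odd; rewrite ClE addnK (@Euclid_dvdM 4) //.
  rewrite (_ : 4 = 2 ^ 2)%N // Euclid_dvdX // andbT dvdn_prime2 //.
  case/orP=> [/eqP p2|pm']; first by rewrite p2 in p_odd.
  by apply: supp; rewrite // dvdn_mulr.
have l_odd : odd l.
  apply: contraT => l_even; apply: False_ind.
  apply: (@even_exponent_absurd C q l m) => //.
  apply: contraLR co => q_even; apply/negP => /eqP qlE.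
  have : (2 %| gcdn q l)%N by rewrite dvdn_gcd !dvdn2 q_even l_even.
  by rewrite qlE.
have C_mod4 : (C %% 4 = 1)%N.
  by have := odd_expn_mod4 C l C_odd l_odd; rewrite ClE; lia.
have l_gt0 : (0 < l)%N by lia.
pose h := gcdn l a.+1.
have h_gt0 : (0 < h)%N by rewrite gcdn_gt0 l_gt0.
have l_h : (l %| h)%N.
  apply: (@expn_subr1_support C) => // p p_pr pl.
  case: (even_prime p_pr) => [p2|p_odd].
    by rewrite p2 dvdn2 oddB ?expn_gt0 ?C_gt0 // oddX C_odd orbT.
  have pM := suppC p p_pr p_odd pl.
  move: pl; rewrite !dvdn_expB1 // => /eqP Cl.
  move: pM; rewrite Euclid_dvdM // => /orP[pm|pB].
    have Cq : (C%:R : 'F_p) ^+ q = 1.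
      by apply/eqP; rewrite -dvdn_expB1 // CqE addnK dvdn_mull.
    have := expr_gcdn_eq1 _ _ _ _ q_gt0 Cq Cl.
    by rewrite (eqP co) expr1 => ->; rewrite expr1n.
  have E : (3 : 'F_p) * C%:R ^+ q = -1.
    apply/eqP; rewrite -addr_eq0 -natrX CqE -natrM natr1 -dvdn_natF //.
    rewrite (_ : (3 * (4 * m + 1)).+1 = 4 * (3 * m + 1))%N; last by lia.
    by rewrite dvdn_mull.
  have E2 : ((3 : 'F_p) ^+ 2) * C%:R ^+ (2 * q) = 1.
    have := congr1 (fun x => x ^+ 2) E.
    by rewrite exprMn -exprM [(q * 2)%N]mulnC sqrrN expr1n.
  have l9 : ((3 : 'F_p) ^+ 2) ^+ l = 1.
    have := congr1 (fun x => x ^+ l) E2.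
    by rewrite exprMn [(C%:R ^+ _) ^+ _]exprAC Cl !expr1n mulr1.
  have a9 : ((3 : 'F_p) ^+ 2) ^+ a.+1 = 1.
    by apply/eqP; rewrite -natrX -dvdn_expB1 // aE dvdn_mull.
  have h9 : ((3 : 'F_p) ^+ 2) ^+ h = 1 by apply: expr_gcdn_eq1.
  have Ch : (C%:R : 'F_p) ^+ (2 * q * h) = 1.
    have := congr1 (fun x => x ^+ h) E2.
    by rewrite exprMn h9 mul1r -exprM expr1n.
  have := expr_gcdn_eq1 _ _ _ _ l_gt0 Cl Ch.
  suff -> : gcdn l (2 * q * h) = h by move=> ->.
  have /Gauss_gcdr -> : coprime l (2 * q).
    by rewrite coprimeMr coprime_sym coprime2n l_odd coprime_sym co.
  by apply/gcdn_idPr/dvdn_gcdl.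
have l_le : (l <= a.+1)%N.
  by apply: dvdn_leq => //; apply: dvdn_trans l_h (dvdn_gcdr _ _).
have C_mod9 : (C %% 9 \in [:: 4; 7])%N.
  have red n i : (0 < n)%N -> (n %% 9 \in [:: 3; 6])%N -> (C ^ i = 4 * n + 1)%N ->
      (C%:R : 'F_3) ^+ i = 1.
    move=> n_gt0 n_mod9 iE; apply/eqP; rewrite -dvdn_expB1 // iE addnK dvdn_mull //.
    by move: n_mod9; rewrite !inE; lia.
  have : (C %% 3 = 1)%N.
    have := expr_gcdn_eq1 _ _ _ _ q_gt0 (red _ _ m_gt0 m_mod9 CqE)
      (red _ _ m'_gt0 m'_mod9 ClE).
    by rewrite (eqP co) => /eqP; rewrite -dvdn_expB1 // expn1; lia.
  suff : (C %% 9 != 1)%N by rewrite !inE; lia.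
  apply/eqP => C1; have : (C ^ q %% 9 = 1)%N by rewrite -modnXm C1 exp1n.
  by move: m_mod9; rewrite CqE !inE; lia.
have dvd3 : (3 ^ e %| C ^ (l - q) - 1)%N.
  have C_lt : (C ^ q < C ^ l)%N by rewrite ltn_exp2l.
  have e_lt : (e <= e')%N.
    by rewrite -(@leq_exp2l 3) // eE e'E; move: C_lt; rewrite CqE ClE; lia.
  have /dvdnP[y yE] : (3 ^ e %| 3 ^ e')%N by rewrite dvdn_exp2l.
  have : (3 ^ e %| (2 * C ^ q) * (C ^ (l - q) - 1))%N.
    rewrite -mulnA mulnBr muln1 -expnD subnKC ?(ltnW q_lt) // CqE ClE.
    by apply/dvdnP; exists (y - 1)%N; rewrite mulnBl -yE; lia.
  rewrite Gauss_dvdr // (_ : 2 * C ^ q = (3 ^ e).-1)%N ?coprimenP ?expn_gt0 //.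
  by rewrite CqE eE; lia.
move: dvd3; rewrite eaE addn1 => /(@expn_subr1_mod3 _ _ _ C_mod9) /dvdn_leq.
move=> /(_ ltac:(lia)); rewrite expnM => le.
have: (a.+1 < (3 ^ 2) ^ a)%N by case: a a_gt0 {aE eaE h l_h h_gt0 l_le le} => // a _;
  elim: a => // a IH; rewrite expnS; lia.
by lia.
Qed.

(** * Representations of c^(2k) by x^2 + E w^2 *)

Lemma PoszX (n k : nat) : (n ^ k)%N%:Z = n%:Z ^+ k.
Proof. by rewrite -!natz natrX. Qed.

(** The pair (x, w) stands for x + w sqrt(-E). *)
Definition qmul (E : int) (g h : int * int) : int * int :=
  (g.1 * h.1 - E * (g.2 * h.2), g.1 * h.2 + g.2 * h.1).

Definition qnorm (E : int) (g : int * int) : int := g.1 ^+ 2 + E * g.2 ^+ 2.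

Definition qpow (E : int) (g : int * int) (n : nat) : int * int :=
  iter n (qmul E g) (1, 0).

Lemma qmulA E : associative (qmul E).
Proof. by case=> a b [c d] [e f]; rewrite /qmul /=; congr (_, _); ring. Qed.

Lemma qmul1 E g : qmul E g (1, 0) = g.
Proof. by case: g => a b; rewrite /qmul /=; congr (_, _); ring. Qed.

Lemma q1mul E g : qmul E (1, 0) g = g.
Proof. by case: g => a b; rewrite /qmul /=; congr (_, _); ring. Qed.

Lemma qnormM E g h : qnorm E (qmul E g h) = qnorm E g * qnorm E h.
Proof. by rewrite /qnorm /qmul /=; ring. Qed.

Lemma qpowS E g n : qpow E g n.+1 = qmul E g (qpow E g n).
Proof. by []. Qed.

Lemma qpow1 E g : qpow E g 1 = g.
Proof. exact: qmul1. Qed.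

Lemma qpowD E g m n : qpow E g (m + n) = qmul E (qpow E g m) (qpow E g n).
Proof.
elim: m => [|m IH]; first by rewrite q1mul.
by rewrite addSn !qpowS IH qmulA.
Qed.

Lemma qpowM E g m n : qpow E g (m * n) = qpow E (qpow E g m) n.
Proof.
elim: n => [|n IH]; first by rewrite muln0.
by rewrite mulnS qpowD IH.
Qed.

(** The congruence modulo 4 selects one of x + w sqrt(-E) and its opposite: for
    a + b = c^k and x = b - a it says that a is even. *)
Definition qrep (E : int) (c k : nat) (g : int * int) : Prop :=
  [/\ qnorm E g = c%:Z ^+ (2 * k), coprimez g.1 c & (4 %| g.1 - c%:Z ^+ k)%Z].

(** Both elements generate powers of the same ideal above c, as opposed to one
    generating a power of an ideal and the other a power of a mixture of it with
    its conjugate: x/w is the same square root of -E modulo c. *)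
Definition same_side (c : nat) (g h : int * int) : bool :=
  (c %| g.1 * h.2 - h.1 * g.2)%Z.

Lemma Euclid_dvdzM (q : nat) (x y : int) : prime q ->
  (q %| x * y)%Z = (q %| x)%Z || (q %| y)%Z.
Proof. by move=> q_pr; rewrite !dvdzE abszM Euclid_dvdM. Qed.

Lemma coprimez_primes (x : int) (c : nat) : (0 < c)%N ->
  reflect (forall q, prime q -> (q %| c)%N -> ~~ (q %| x)%Z) (coprimez x c).
Proof.
move=> c_gt0; rewrite coprimezE; apply: (iffP idP) => [co q q_pr qc|no].
  apply/negP => qx; have : (q %| gcdn `|x| c)%N by rewrite dvdn_gcd qc andbT.
  by rewrite (eqP co) Euclid_dvd1.
rewrite /coprime; apply: contraT => gcd_neq1.
have gcd_gt0 : (0 < gcdn `|x| c)%N by rewrite gcdn_gt0 c_gt0 orbT.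
have q_dvd := pdiv_dvd (gcdn `|x| c).
have q_pr : prime (pdiv (gcdn `|x| c)).
  by apply: pdiv_prime; rewrite ltn_neqAle eq_sym gcd_neq1.
have := no _ q_pr (dvdn_trans q_dvd (dvdn_gcdr _ _)).
by rewrite dvdzE (dvdn_trans q_dvd (dvdn_gcdl _ _)).
Qed.

Section Representations.
Variables (E : int) (c : nat).
Hypotheses (E_gt4 : 4 < E) (E4 : (4 %| E)%Z) (c_odd : odd c) (c_gt1 : (1 < c)%N).
Hypothesis (cE : coprimez E c).

Let c_gt0 : (0 < c)%N. Proof. exact: ltnW. Qed.

Lemma qrep_coprime2 k g : (0 < k)%N -> qrep E c k g -> coprimez g.2 c.
Proof.
move=> k_gt0 [norm /(coprimez_primes _ _ c_gt0) co _].
apply/(coprimez_primes _ _ c_gt0) => q q_pr qc; apply: contra (co q q_pr qc) => q2.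
have : (q %| g.1 * g.1)%Z.
  rewrite -expr2 (_ : g.1 ^+ 2 = c%:Z ^+ (2 * k) - E * g.2 * g.2); last first.
    by rewrite -norm /qnorm; ring.
  rewrite rpredB ?dvdz_mull //; apply: dvdz_exp; rewrite ?dvdzE //; lia.
by rewrite Euclid_dvdzM // orbb.
Qed.

Lemma qnorm1 g : qnorm E g = 1 -> g.1 ^+ 2 = 1 /\ g.2 = 0.
Proof.
case: g => x w; rewrite /qnorm /= => norm.
have w0 : w = 0.
  apply/eqP; apply: contraT => w_neq0.
  have : 1 <= w ^+ 2 by rewrite -gtz0_ge1 exprn_even_gt0.
  by have := sqr_ge0 x; clear -E_gt4 norm; nia.
by rewrite w0 in norm *; split=> //; clear -norm; lia.
Qed.

Lemma qrep_norm1 g : qrep E c 0 g -> g = (1, 0).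
Proof.
case; rewrite muln0 expr0 => /qnorm1; case: g => x w /= [x2 ->] _.
have /orP[/eqP-> //|/eqP->] : (x == 1) || (x == -1) by rewrite -sqrf_eq1 x2.
by [].
Qed.

(** The quotient is conj(g) h / c^(2k).  The product of x w' - x' w and
    x w' + x' w is divisible by c^(2k); being on the same side makes the second
    factor coprime to c, so the first one is divisible by c^(2k), and then so is
    x x' + E w w'. *)
Lemma qrep_div k l g h : (0 < k <= l)%N -> qrep E c k g -> qrep E c l h ->
  same_side c g h ->
  exists d, [/\ h = qmul E g d, qrep E c (l - k) d &
                (k < l)%N -> same_side c g d].
Proof.
move=> /andP[k_gt0 k_le] g_rep h_rep; have l_gt0 := leq_trans k_gt0 k_le.
have := qrep_coprime2 _ _ l_gt0 h_rep; have := qrep_coprime2 _ _ k_gt0 g_rep.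
case: g g_rep => x w [/= norm_g co_x mod_x].
case: h h_rep => x' w' [/= norm_h co_x' mod_x'] co_w co_w'.
rewrite /same_side /= => side.
pose P : int := c%:Z ^+ k; pose P2 : int := c%:Z ^+ (l - k).
have lE : c%:Z ^+ l = P * P2 by rewrite -exprD subnKC.
have normg : x ^+ 2 + E * w ^+ 2 = P ^+ 2 by rewrite -exprM mulnC -norm_g.
have normh : x' ^+ 2 + E * w' ^+ 2 = P ^+ 2 * P2 ^+ 2.
  by rewrite -exprMn -lE -exprM mulnC -norm_h.
have P_neq0 : P ^+ 2 != 0 by rewrite !expf_neq0 //; lia.
have cN_odd q : prime q -> (q %| c)%N -> ~~ (q %| 2)%Z.
  move=> q_pr qc; rewrite dvdzE /= dvdn_prime2 //; apply/negP => /eqP q2.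
  by rewrite q2 dvdn2 c_odd in qc.
have co_sum : coprimez (P ^+ 2) (x * w' + x' * w).
  rewrite coprimez_sym !coprimezXr //.
  apply/(coprimez_primes _ _ c_gt0) => q q_pr qc; apply/negP => q_sum.
  have : (q %| 2 * x * w')%Z.
    rewrite (_ : 2 * x * w' = (x * w' + x' * w) + (x * w' - x' * w)); last by ring.
    by rewrite rpredD // (dvdz_trans _ side) // dvdzE.
  rewrite !Euclid_dvdzM // (negbTE (cN_odd q q_pr qc)).
  have /(coprimez_primes _ _ c_gt0)/(_ q q_pr qc)/negbTE-> := co_x.
  by have /(coprimez_primes _ _ c_gt0)/(_ q q_pr qc)/negbTE-> := co_w'.
have N_diff : (P ^+ 2 %| x * w' - x' * w)%Z.
  rewrite -(Gauss_dvdzl _ co_sum); apply/dvdzP.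
  exists (w' ^+ 2 - P2 ^+ 2 * w ^+ 2).
  transitivity ((x ^+ 2 + E * w ^+ 2) * w' ^+ 2 - (x' ^+ 2 + E * w' ^+ 2) * w ^+ 2).
    by ring.
  by rewrite normg normh; ring.
have N_dot : (P ^+ 2 %| x * x' + E * (w * w'))%Z.
  have co : coprimez (P ^+ 2) x by rewrite coprimez_sym !coprimezXr.
  rewrite -(Gauss_dvdzr _ co) (_ : x * _ = P ^+ 2 * x' + E * w * (x * w' - x' * w)).
    by rewrite rpredD //; [apply: dvdz_mulr | apply: dvdz_mull].
  by rewrite -normg; ring.
have /dvdzP[v vE] := N_diff; have /dvdzP[u uE] := N_dot.
have hE : (x', w') = qmul E (x, w) (u, v).
  rewrite /qmul /=; congr (_, _); apply: (mulIf P_neq0).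
    transitivity (x * (u * P ^+ 2) - E * w * (v * P ^+ 2)); last by ring.
    by rewrite -uE -vE -normg; ring.
  transitivity (x * (v * P ^+ 2) + w * (u * P ^+ 2)); last by ring.
  by rewrite -uE -vE -normg; ring.
have normd : qnorm E (u, v) = P2 ^+ 2.
  apply: (mulfI P_neq0); rewrite -normh -[LHS]/(P ^+ 2 * qnorm E (u, v)).
  by rewrite -normg -[LHS](qnormM E (x, w) (u, v)) -hE.
case: hE => x'E w'E.
exists (u, v); split=> [|| k_lt].
- by rewrite /qmul /= -x'E -w'E.
- split=> /=; first by rewrite normd /P2 -exprM mulnC.
  + apply/(coprimez_primes _ _ c_gt0) => q q_pr qc; apply/negP => q_u.
    have /(coprimez_primes _ _ c_gt0)/(_ q q_pr qc)/negP := co_x'; apply.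
    have [k_lt|l_le] := ltnP k l; last first.
      have : qnorm E (u, v) = 1.
        have lk0 : (l - k = 0)%N by apply/eqP; rewrite subn_eq0.
        by rewrite normd /P2 lk0 expr0 expr1n.
      case/qnorm1 => /= u2 _; have : (q %| u * u)%Z by rewrite dvdz_mull.
      by rewrite -expr2 u2 dvdz1 absz_nat gtn_eqF // prime_gt1.
    have q_v : (q %| v)%Z.
      have : (q %| E * (v * v))%Z.
        rewrite (_ : E * _ = P2 ^+ 2 - u * u); last by rewrite -normd /qnorm /=; ring.
        have qP2 : (q %| P2)%Z by rewrite /P2 dvdz_exp // subn_gt0.
        by rewrite rpredB ?dvdz_mull.
      rewrite !Euclid_dvdzM // orbb.
      by have /(coprimez_primes _ _ c_gt0)/(_ q q_pr qc)/negbTE-> := cE.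
    by rewrite x'E rpredB ?dvdz_mull.
  + have co : coprimez 4 (P ^+ 2).
      by rewrite !coprimezXr // coprimezE /= (@coprimeXl 2 2) // coprime2n.
    rewrite -(Gauss_dvdzl _ co) mulrBl -uE.
    rewrite (_ : _ - _ = x * (x' - c%:Z ^+ l) + c%:Z ^+ l * (x - P) + E * (w * w')).
      by rewrite !rpredD //; [apply: dvdz_mull | apply: dvdz_mull | apply: dvdz_mulr].
    by rewrite lE /P2; ring.
- have co : coprimez c w' by rewrite coprimez_sym.
  rewrite /same_side /= -(Gauss_dvdzl _ co) w'E.
  have normd' : u ^+ 2 + E * v ^+ 2 = P2 ^+ 2 by [].
  have -> : (x * v - u * w) * (x * v + w * u) =
      (x ^+ 2 + E * w ^+ 2) * v ^+ 2 - (u ^+ 2 + E * v ^+ 2) * w ^+ 2 by ring.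
  rewrite normg normd' !expr2 -!mulrA.
  by rewrite rpredB // dvdz_mulr // dvdz_exp // subn_gt0.
Qed.

Lemma same_side_trans k f g h : qrep E c k g ->
  same_side c f g -> same_side c g h -> same_side c f h.
Proof.
move=> [_ co _]; rewrite coprimez_sym in co; rewrite /same_side => fg gh.
rewrite -(Gauss_dvdzr _ co).
rewrite (_ : _ * _ = f.1 * (g.1 * h.2 - h.1 * g.2) + h.1 * (f.1 * g.2 - g.1 * f.2)).
  by rewrite rpredD ?dvdz_mull.
by ring.
Qed.

Lemma same_side_sym g h : same_side c g h = same_side c h g.
Proof. by rewrite /same_side -rpredN opprB. Qed.

Lemma same_side_refl g : same_side c g g.
Proof. by rewrite /same_side subrr dvdz0. Qed.

(** A common prime of c and of the first coordinate of g would divide the whole of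
    g, hence each of its powers. *)
Lemma qrep_pow_base k l g n : (0 < k)%N -> (0 < n)%N -> qnorm E g = c%:Z ^+ (2 * k) ->
  (4 %| g.1 - c%:Z ^+ k)%Z -> qrep E c l (qpow E g n) -> qrep E c k g.
Proof.
move=> k_gt0; case: n => // n _ norm mod4 [_ co _]; split=> //.
apply/(coprimez_primes _ _ c_gt0) => q q_pr qc; apply/negP => q_x.
have /(coprimez_primes _ _ c_gt0)/(_ q q_pr qc)/negP := co; apply.
have q_w : (q %| g.2)%Z.
  have : (q %| E * (g.2 * g.2))%Z.
    rewrite (_ : E * _ = c%:Z ^+ (2 * k) - g.1 * g.1); last by rewrite -norm /qnorm; ring.
    by rewrite rpredB ?dvdz_mull // dvdz_exp ?dvdzE //; lia.
  rewrite !Euclid_dvdzM // orbb.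
  by have /(coprimez_primes _ _ c_gt0)/(_ q q_pr qc)/negbTE-> := cE.
by rewrite qpowS /qmul /= rpredB //; [|apply: dvdz_mull]; apply: dvdz_mulr.
Qed.

Lemma qpow_norm g k n : qnorm E g = c%:Z ^+ (2 * k) ->
  qnorm E (qpow E g n) = c%:Z ^+ (2 * (k * n)).
Proof.
move=> norm; elim: n => [|n IH]; first by rewrite muln0 muln0 expr0 /qnorm /=; ring.
by rewrite qpowS qnormM IH norm -exprD mulnS mulnDr.
Qed.

Lemma qpow_mod4 g k n : (4 %| g.1 - c%:Z ^+ k)%Z ->
  (4 %| (qpow E g n).1 - c%:Z ^+ (k * n))%Z.
Proof.
move=> mod4; elim: n => [|n IH]; first by rewrite muln0 expr0 subrr dvdz0.
rewrite qpowS mulnS exprD /qmul /=.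
set x := g.1 in mod4 *; set y := (qpow E g n).1 in IH *.
rewrite (_ : _ - _ = x * (y - c%:Z ^+ (k * n)) + c%:Z ^+ (k * n) * (x - c%:Z ^+ k)
  - E * (g.2 * (qpow E g n).2)); last by ring.
rewrite rpredB ?rpredD //; [exact: dvdz_mull | exact: dvdz_mull |].
exact: dvdz_mulr.
Qed.

(** The representations on the side of g are closed under division, so by
    Euclidean division of exponents they are the powers of the one of least
    positive exponent k0.  As k0 <= k < l, h is a power with exponent n > 1, hence
    an r-th power for a prime divisor r of n. *)
Lemma qrep_prime_root k l g h : (0 < k < l)%N -> qrep E c k g -> qrep E c l h ->
  same_side c g h ->
  exists r j d, [/\ prime r, l = (j * r)%N, (0 < j)%N, qrep E c j d & h = qpow E d r].
Proof.
move=> /andP[k_gt0 k_lt] g_rep h_rep gh.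
pose pr j := `[< (0 < j)%N /\ exists2 d, qrep E c j d & same_side c g d >].
have ex_pr : exists j, pr j.
  by exists k; apply/asboolP; split=> //; exists g => //; apply: same_side_refl.
case: (ex_minnP ex_pr) => k0 /asboolP[k0_gt0 [g0 g0_rep gg0]] k0_min.
have powers n : forall d, qrep E c n d -> same_side c g d -> (0 < n)%N ->
    exists m, n = (k0 * m)%N /\ d = qpow E g0 m.
  elim/ltn_ind: n => n IH d d_rep gd n_gt0.
  have k0_le : (k0 <= n)%N by apply: k0_min; apply/asboolP; split=> //; exists d.
  have g0d : same_side c g0 d.
    by apply: (same_side_trans _ _ _ _ g_rep _ gd); rewrite same_side_sym.
  have k0_n : (0 < k0 <= n)%N by rewrite k0_gt0.
  have [d' [dE d'_rep side]] := qrep_div _ _ _ _ k0_n g0_rep d_rep g0d.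
  have [n_le|k0_lt] := leqP n k0.
    exists 1%N; split; first by lia.
    have d'1 : d' = (1, 0) by apply: qrep_norm1; have <- : (n - k0 = 0)%N by lia.
    by rewrite dE d'1 qpow1 qmul1.
  have := IH (n - k0)%N; case/(_ _ d') => //; try lia.
    exact: same_side_trans g0_rep gg0 (side k0_lt).
  by move=> m [nE d'E]; exists m.+1; rewrite qpowS -d'E; split=> //; lia.
have k0_le : (k0 <= k)%N.
  by apply: k0_min; apply/asboolP; split=> //; exists g => //; apply: same_side_refl.
have [n [lE hE]] := powers l h h_rep gh ltac:(lia).
have n_gt1 : (1 < n)%N by nia.
have /dvdnP[m nE] := pdiv_dvd n.
have r_pr := pdiv_prime n_gt1.
have m_gt0 : (0 < m)%N by case: m nE => [|//] nE; rewrite nE mul0n in n_gt1.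
have hE' : h = qpow E (qpow E g0 m) (pdiv n) by rewrite hE {1}nE qpowM.
exists (pdiv n), (k0 * m)%N, (qpow E g0 m); split=> //.
- by rewrite lE {1}nE mulnA.
- by rewrite muln_gt0 k0_gt0.
- case: g0_rep => norm _ mod4.
  apply: (@qrep_pow_base _ l _ (pdiv n)); rewrite ?muln_gt0 ?k0_gt0 ?pdiv_gt0 //.
  + exact: qpow_norm.
  + exact: qpow_mod4.
  + by rewrite -hE'.
Qed.
End Representations.

(** * Odd powers of sqrt B + sqrt (-A) *)

(** The integers F, G with (sqrt B + sqrt (-A))^(2m+1) = F sqrt B + G sqrt (-A);
    each step multiplies by (sqrt B + sqrt (-A))^2 = B - A + 2 sqrt (-AB). *)
Definition odd_parts (A B : int) (m : nat) : int * int :=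
  iter m (fun p => ((B - A) * p.1 - 2 * A * p.2, (B - A) * p.2 + 2 * B * p.1)) (1, 1).

Lemma odd_partsS A B m : odd_parts A B m.+1 =
  ((B - A) * (odd_parts A B m).1 - 2 * A * (odd_parts A B m).2,
   (B - A) * (odd_parts A B m).2 + 2 * B * (odd_parts A B m).1).
Proof. by []. Qed.

Lemma odd_parts_norm A B m :
  B * (odd_parts A B m).1 ^+ 2 + A * (odd_parts A B m).2 ^+ 2 = (A + B) ^+ (2 * m + 1).
Proof.
elim: m => [|m IH]; first by rewrite expr1 /=; ring.
rewrite odd_partsS /=; case: (odd_parts A B m) IH => F G /= IH.
rewrite (_ : (2 * m.+1 + 1 = 2 + (2 * m + 1))%N); last by lia.
by rewrite exprD -IH; ring.
Qed.

(** Exchanging A and B multiplies sqrt B + sqrt (-A) by a fourth root of unity and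
    conjugates it, so every statement on G gives one on F. *)
Lemma odd_parts_swap A B m : odd_parts B A m =
  ((-1) ^+ m * (odd_parts A B m).2, (-1) ^+ m * (odd_parts A B m).1).
Proof.
elim: m => [|m IH]; first by rewrite expr0 /= !mulr1.
by rewrite odd_partsS IH odd_partsS exprS /=; congr (_, _); ring.
Qed.

(** The leading terms of the binomial expansions of F and G. *)
Lemma odd_parts_mod A B m : (A %| (odd_parts A B m).1 - B ^+ m)%Z /\
  (A %| (odd_parts A B m).2 - (2 * m + 1)%N%:Z * B ^+ m)%Z.
Proof.
elim: m => [|m []]; first by rewrite /= expr0 mulr1 subrr dvdz0.
rewrite odd_partsS; case: (odd_parts A B m) => F G /=.
move=> /dvdzP[f fE] /dvdzP[g gE].
have {fE} -> : F = f * A + B ^+ m by rewrite -fE; ring.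
have {gE} -> : G = g * A + (2 * m + 1)%N%:Z * B ^+ m by rewrite -gE; ring.
split; apply/dvdzP; rewrite exprS.
  exists (B * f - f * A - B ^+ m - 2 * (g * A + (2 * m + 1)%N%:Z * B ^+ m)).
  by ring.
exists (B * g - g * A - (2 * m + 1)%N%:Z * B ^+ m + 2 * B * f).
by rewrite !PoszD !PoszM -addn1 PoszD; ring.
Qed.

(** The first two terms of the binomial expansions; m(2m+1) and k are the binomial
    coefficients of 2m+1 over 2 and over 3.  Multiplying by B avoids the
    exponent m - 1. *)
Lemma odd_parts_mod_sq A B m : exists f g k : int,
  [/\ B * (odd_parts A B m).1 =
        B ^+ m.+1 - m%:Z * (2 * m%:Z + 1) * B ^+ m * A + f * A ^+ 2,
      B * (odd_parts A B m).2 =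
        (2 * m%:Z + 1) * B ^+ m.+1 - k * B ^+ m * A + g * A ^+ 2 &
      3 * k = m%:Z * (2 * m%:Z - 1) * (2 * m%:Z + 1)].
Proof.
elim: m => [|m [f [g [k [fE gE kE]]]]].
  by exists 0, 0, 0; split; rewrite /= ?expr0 ?expr1; ring.
rewrite odd_partsS; case: (odd_parts A B m) fE gE => F G /= fE gE.
set M := m%:Z in kE fE gE *; have ME : m.+1%:Z = M + 1 by rewrite -addn1 PoszD.
pose fm := M * (2 * M + 1).
exists (B * f + fm * B ^+ m - A * f + 2 * k * B ^+ m - 2 * A * g).
exists (B * g + k * B ^+ m - A * g + 2 * B * f), (k + (2 * M + 1) + 2 * fm).
split.
- transitivity ((B - A) * (B * F) - 2 * A * (B * G)); first by ring.
  by rewrite fE gE ME !exprS /fm; ring.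
- transitivity ((B - A) * (B * G) + 2 * B * (B * F)); first by ring.
  by rewrite fE gE ME !exprS /fm; ring.
- by rewrite !mulrDr kE ME /fm; ring.
Qed.

Lemma coprimez_prime (x y : int) (p : nat) : prime p -> coprimez x y ->
  (p %| x)%Z -> (p %| y)%Z -> False.
Proof.
rewrite coprimezE !dvdzE absz_nat => p_pr co px py.
have : (p %| gcdn `|x| `|y|)%N by rewrite dvdn_gcd px.
by rewrite (eqP co) Euclid_dvd1.
Qed.

Lemma prime_dvdzX (p n : nat) (x : int) : prime p -> (p %| x ^+ n)%Z -> (p %| x)%Z.
Proof. by move=> p_pr; rewrite !dvdzE abszX !absz_nat Euclid_dvdX // => /andP[]. Qed.

(** Modulo a prime of A one has G = (2m+1) B^m, and modulo a prime of B one has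
    G = (-A)^m, a unit. *)
Lemma odd_parts_prime A B m p : coprimez A B -> prime p -> prime (2 * m + 1) ->
  (p %| (odd_parts A B m).2)%Z -> (p %| A * B)%Z ->
  p = (2 * m + 1)%N /\ (p %| A)%Z.
Proof.
move=> co p_pr r_pr pG; rewrite Euclid_dvdzM // => /orP[pA|pB].
  split=> //; have [_ /(dvdz_trans pA)] := odd_parts_mod A B m.
  rewrite rpredBl // Euclid_dvdzM // => /orP[|/(prime_dvdzX _ _ _ p_pr) pB].
    by rewrite dvdzE !absz_nat dvdn_prime2 // => /eqP.
  by case: (coprimez_prime _ _ _ p_pr co pA pB).
have [/(dvdz_trans pB)] := odd_parts_mod B A m.
rewrite odd_parts_swap /= rpredBl ?dvdz_mull // => /(prime_dvdzX _ _ _ p_pr) pA.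
by case: (coprimez_prime _ _ _ p_pr co pA pB).
Qed.

(** For a prime r = 2m+1 > 3 dividing A, the second term of the expansion of G is
    divisible by r^2, since r divides the binomial coefficient of r over 3, and the
    first one is exactly divisible by r.  For r = 3 this fails, and the exceptional
    family of special_cube arises. *)
Lemma odd_parts_not_sq A B m : coprimez A B -> prime (2 * m + 1) -> (1 < m)%N ->
  ((2 * m + 1)%N %| A)%Z -> ((2 * m + 1)%N%:Z ^+ 2 %| (odd_parts A B m).2)%Z -> False.
Proof.
move=> co r_pr m_gt1 rA rG.
have [f [g [k [_ gE kE]]]] := odd_parts_mod_sq A B m.
set r := (2 * m + 1)%N in r_pr rA rG.
have rE : (2 * m%:Z + 1) = r by rewrite /r PoszD PoszM.
have [a aE] := dvdzP rA; have [b bE] := dvdzP rG.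
have r_neq0 : r%:Z != 0 by have := prime_gt0 r_pr; lia.
have r3 : coprime r 3 by rewrite prime_coprime // dvdn_prime2 // /r; lia.
have [j jE] : exists j : int, k = j * r%:Z.
  have co3 : coprimez r 3 by [].
  by apply/dvdzP; rewrite -(Gauss_dvdzr _ co3) kE rE dvdz_mull.
have : (r %| B ^+ m.+1)%Z.
  apply/dvdzP; exists (B * b + j * B ^+ m * a - g * a ^+ 2).
  apply: (mulfI r_neq0); move: gE; rewrite rE bE jE aE => gE.
  transitivity (B * (b * r ^+ 2) + j * r * B ^+ m * (a * r) - g * (a * r) ^+ 2).
    2: by ring.
  by rewrite gE; ring.
by move/(prime_dvdzX _ _ _ r_pr); apply: coprimez_prime co rA.
Qed.

Lemma odd_parts_power A B m : coprimez A B -> prime (2 * m + 1) ->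
  (odd_parts A B m).2 != 0 ->
  (forall p, prime p -> (p %| (odd_parts A B m).2)%Z -> (p %| A * B)%Z) ->
  exists s, [/\ (odd_parts A B m).2 ^+ 2 = ((2 * m + 1) ^ s)%N%:Z ^+ 2,
    (0 < s)%N -> ((2 * m + 1)%N %| A)%Z & (1 < m)%N -> (s <= 1)%N].
Proof.
move=> co r_pr G_neq0 supp.
have G_only p : prime p -> (p %| `|(odd_parts A B m).2|)%N ->
    p = (2 * m + 1)%N /\ (p %| A)%Z.
  by move=> p_pr pG; apply: (odd_parts_prime A B) => //; apply: supp.
have [|p p_pr /(G_only p p_pr)[]//|s sE] :=
  only_prime_divisor (2 * m + 1) `|(odd_parts A B m).2|.
  by rewrite absz_gt0.
exists s; split.
- by rewrite -sE -[LHS]real_normK ?num_real // abszE.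
- by move=> s_gt0; apply: (G_only _ r_pr _).2; rewrite sE dvdn_exp.
- move=> m_gt1; rewrite leqNgt; apply/negP => s_gt1.
  have rA : ((2 * m + 1)%N %| A)%Z.
    by apply: (G_only _ r_pr _).2; rewrite sE dvdn_exp // ltnW.
  apply: (odd_parts_not_sq A B m co r_pr m_gt1 rA).
  by rewrite dvdzE abszX sE absz_nat dvdn_exp2l.
Qed.

Lemma expn9_gt m : (1 < m)%N -> ((2 * m + 1) ^ 2 < 9 ^ m)%N.
Proof.
case: m => [|[|m]] // _; elim: m => // m; rewrite [(9 ^ m.+3)%N]expnS.
by move: (9 ^ m.+2)%N => y; rewrite -!mulnn; lia.
Qed.

(** F and G are, up to sign, powers of r = 2m+1, and one of them is a unit because
    r cannot divide both A and B.  If r > 3 the exponents are at most 1, so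
    (A + B)^r = B F^2 + A G^2 <= r^2 (A + B), which is impossible. *)
Lemma odd_parts_cube A B m : 0 < A -> 0 < B -> 3 <= A + B -> coprimez A B ->
  prime (2 * m + 1) -> (0 < m)%N ->
  (odd_parts A B m).1 != 0 -> (odd_parts A B m).2 != 0 ->
  (forall p, prime p -> (p %| (odd_parts A B m).1)%Z -> (p %| A * B)%Z) ->
  (forall p, prime p -> (p %| (odd_parts A B m).2)%Z -> (p %| A * B)%Z) ->
  m = 1%N /\ exists s,
   ((odd_parts A B m).1 ^+ 2 = 1 /\ (odd_parts A B m).2 ^+ 2 = (3 ^ s)%N%:Z ^+ 2) \/
   ((odd_parts A B m).2 ^+ 2 = 1 /\ (odd_parts A B m).1 ^+ 2 = (3 ^ s)%N%:Z ^+ 2).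
Proof.
move=> A_gt0 B_gt0 AB_ge3 co r_pr m_gt0 F_neq0 G_neq0 suppF suppG.
have [s [GE s_A s_le]] := odd_parts_power _ _ _ co r_pr G_neq0 suppG.
have [t [FE t_B t_le]] : exists t,
  [/\ (odd_parts A B m).1 ^+ 2 = ((2 * m + 1) ^ t)%N%:Z ^+ 2,
    (0 < t)%N -> ((2 * m + 1)%N %| B)%Z & (1 < m)%N -> (t <= 1)%N].
  have := odd_parts_power B A m; rewrite odd_parts_swap /= exprMn sqrr_sign mul1r.
  apply=> //; first by rewrite coprimez_sym.
    by rewrite mulf_neq0 // signr_eq0.
  move=> p p_pr; rewrite mulrC -signr_odd [B * A]mulrC => pF; apply: suppF => //.
  by move: pF; case: odd; rewrite ?expr0 ?expr1 ?mulr1 // mulrN1 dvdzE abszN -dvdzE.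
have st0 : s = 0%N \/ t = 0%N.
  case: s s_A {GE s_le} => [|s] s_A; [by left|].
  case: t t_B {FE t_le} => [|t] t_B; [by right|].
  by case: (coprimez_prime _ _ _ r_pr co (s_A isT) (t_B isT)).
have m1 : m = 1%N.
  apply/eqP; apply: contraT => m_neq1; have m_gt1 : (1 < m)%N by lia.
  have bound i : (i <= 1)%N -> ((2 * m + 1) ^ i)%N%:Z ^+ 2 <= ((2 * m + 1) ^ 2)%N%:Z.
    by move=> i_le; rewrite -PoszX lez_nat -expnM leq_exp2l; clear -i_le m_gt1; lia.
  have := odd_parts_norm A B m; rewrite GE FE => norm.
  have : (A + B) ^+ (2 * m + 1) <= ((2 * m + 1) ^ 2)%N%:Z * (A + B).
    rewrite -norm [_ * (A + B)]mulrDr addrC lerD // mulrC ler_wpM2r ?bound //;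
      try exact: ltW.
      by apply: s_le.
    by apply: t_le.
  rewrite exprD expr1 ler_pM2r; last by lia.
  have : (9 ^ m)%N%:Z <= (A + B) ^+ (2 * m).
    rewrite (_ : 9 ^ m = (3 ^ (2 * m)))%N; last by rewrite expnM.
    by rewrite PoszX lerXn2r // nnegrE; lia.
  move=> le1 le2; have := le_trans le1 le2.
  by rewrite lez_nat leqNgt expn9_gt.
split=> //; move: FE GE; rewrite m1 => FE GE.
case: st0 => s0; rewrite s0 in FE GE.
- by exists t; right; rewrite GE expn0 expr1n.
- by exists s; left; rewrite FE expn0 expr1n.
Qed.

(** With AB = D w^2, (sqrt B + sqrt (-A))^2 is B - A + w sqrt (-4D). *)
Lemma qpow_odd (D A B w : int) m : A * B = D * w ^+ 2 ->
  qpow (4 * D) (B - A, w) (2 * m + 1) =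
  (B * (odd_parts A B m).1 ^+ 2 - A * (odd_parts A B m).2 ^+ 2,
   w * ((odd_parts A B m).1 * (odd_parts A B m).2)).
Proof.
move=> AB; elim: m => [|m IH]; first by rewrite qpow1 /=; congr (_, _); ring.
rewrite (_ : (2 * m.+1 + 1 = (2 * m + 1).+2)%N); last by lia.
rewrite !qpowS IH odd_partsS; case: (odd_parts A B m) => F G /=.
have Ew : 4 * D * (w * w) = 4 * (A * B) by rewrite AB; ring.
rewrite /qmul /=; congr (_, _); last first.
  set X := B * F ^+ 2 - _; set Y := F * G.
  transitivity (w * ((B - A) * ((B - A) * Y + X) + ((B - A) * X - 4 * D * (w * w) * Y))).
    by ring.
  by rewrite Ew /X /Y; ring.
set X := B * F ^+ 2 - _; set Y := F * G.
transitivity ((B - A) * ((B - A) * X - 4 * D * (w * w) * Y)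
   - 4 * D * (w * w) * ((B - A) * Y + X)); first by ring.
by rewrite Ew /X /Y; ring.
Qed.

Lemma qpow_w0 (E x : int) n : (qpow E (x, 0) n).2 = 0.
Proof. by elim: n => // n IH; rewrite qpowS /qmul /= IH; ring. Qed.

(** * Solutions with prescribed prime support *)

Definition solution (c : nat) (U : seq nat) (t : nat * nat * nat) : bool :=
  let: (a, b, z) := t in
  [&& (0 < a)%N, (0 < b)%N, (0 < z)%N, ~~ odd a, (a + b)%N == (c ^ z)%N
    & primes (a * b) == U].

(** The necessary form of a square delta^2: then (a, b) = (4AB, 1) for consecutive
    integers A, B, and a + b is the square of A + B, a power of c. *)
Definition special_square (t : nat * nat * nat) : Prop :=
  t.1.2 = 1%N /\ exists j, t.2 = (2 * j)%N.

(** The cubes delta^3: here delta comes from the pair {m, 3m + 1}, whose sum is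
    c^k. *)
Definition special_cube (c : nat) (t : nat * nat * nat) : Prop :=
  exists k m e, [/\ (0 < m)%N, (c ^ k = 4 * m + 1)%N, (3 ^ e = 8 * m + 3)%N,
    t.2 = (3 * k)%N &
    t.1 = (m * (3 ^ e) ^ 2, 3 * m + 1)%N \/ t.1 = (3 * m + 1, m * (3 ^ e) ^ 2)%N].

(** Twice a vector of the lattice of relations modulo c separates the exponent
    vectors of t.1.1 / t.1.2 and t'.1.1 / t'.1.2: their quotient is the square of
    s / (t.1.2 * t'.1.1), and this number is 1 or -1 modulo c. *)
Definition related (c : nat) (t t' : nat * nat * nat) : Prop :=
  exists s, (s ^ 2 = t.1.1 * t.1.2 * (t'.1.1 * t'.1.2))%N /\
    ((c %| s%:Z - (t.1.2 * t'.1.1)%N%:Z) || (c %| s%:Z + (t.1.2 * t'.1.1)%N%:Z))%Z.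

Lemma coprime_mul_sqr (x y s : nat) : coprime x y -> (x * y = s ^ 2)%N ->
  x = (gcdn x s ^ 2)%N.
Proof.
move=> co xy; set g := gcdn x s.
have: (x * gcdn g (gcdn s y) = g * g)%N.
  rewrite muln_gcdr (_ : x * gcdn s y = s * g)%N; last first.
    by rewrite !muln_gcdr xy mulnn [(s * x)%N]mulnC.
  by rewrite -muln_gcdl.
suff -> : gcdn g (gcdn s y) = 1%N by rewrite muln1 mulnn.
apply/eqP; rewrite -dvdn1 -(eqP co) dvdn_gcd.
rewrite (dvdn_trans (dvdn_gcdl _ _) (dvdn_gcdl _ _)).
by rewrite (dvdn_trans (dvdn_gcdr _ _) (dvdn_gcdr _ _)).
Qed.

Lemma common_square_class (t1 t2 s : nat) : (0 < t1)%N -> (0 < t2)%N ->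
  (s ^ 2 = t1 * t2)%N ->
  exists u1 u2, [/\ (t1 = gcdn t1 t2 * u1 ^ 2)%N, (t2 = gcdn t1 t2 * u2 ^ 2)%N
     & (s = gcdn t1 t2 * u1 * u2)%N].
Proof.
move=> t1_gt0 t2_gt0 st; set D := gcdn t1 t2.
have D_gt0 : (0 < D)%N by rewrite gcdn_gt0 t1_gt0.
have /dvdnP[x xE] : (D %| t1)%N by apply: dvdn_gcdl.
have /dvdnP[y yE] : (D %| t2)%N by apply: dvdn_gcdr.
have co : coprime x y by rewrite /coprime -(eqn_pmul2r D_gt0) muln_gcdl -xE -yE mul1n.
have Ds : (D %| s)%N.
  by rewrite -(@dvdn_pexp2r _ _ 2) // st xE yE -mulnn dvdn_mul ?dvdn_mull.
have /dvdnP[v vE] := Ds.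
have xy : (x * y = v ^ 2)%N.
  apply/eqP; rewrite -(@eqn_pmul2r (D ^ 2)) ?expn_gt0 ?D_gt0 //.
  by rewrite -expnMn -vE st xE yE; apply/eqP; ring.
have xs := coprime_mul_sqr x y v co xy.
have ys : y = (gcdn y v ^ 2)%N.
  by apply: (@coprime_mul_sqr _ x); rewrite 1?coprime_sym // mulnC.
exists (gcdn x v), (gcdn y v); split; first by rewrite -xs mulnC.
  by rewrite -ys mulnC.
rewrite [LHS]vE mulnC -mulnA; congr (_ * _)%N; apply/eqP.
by rewrite -(@eqn_exp2r _ _ 2) // expnMn -xs -ys xy.
Qed.

Section KeyLemma.
Variables (c : nat) (U : seq nat).
Hypotheses (c_odd : odd c) (c_gt1 : (1 < c)%N).
Hypothesis (cU : forall p, p \in U -> ~~ (p %| c)%N).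

Lemma solution_support t p : solution c U t -> prime p ->
  (p %| t.1.1 * t.1.2)%N = (p \in U).
Proof.
case: t => [[a b] z] /and5P[a0 b0 _ _ /andP[_ /eqP <-]] p_pr.
by rewrite mem_primes p_pr muln_gt0 a0 b0.
Qed.

Lemma solution_coprime a b z q : solution c U (a, b, z) -> prime q -> (q %| c)%N ->
  [/\ ~~ (q %| a)%N, ~~ (q %| b)%N & ~~ (q %| a * b)%N].
Proof.
move=> sol q_pr qc; have : ~~ (q %| a * b)%N.
  by rewrite (solution_support _ _ sol q_pr); apply: contraL qc; apply: cU.
by rewrite Euclid_dvdM // negb_or => /andP[-> ->].
Qed.

(** The element (sqrt b + sqrt (-a))^2. *)
Lemma solution_qrep a b z (D u : nat) (w : int) : solution c U (a, b, z) ->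
  (a * b = D * u ^ 2)%N -> w ^+ 2 = u%:Z ^+ 2 ->
  qrep (4 * D%:Z) c z (b%:Z - a%:Z, w).
Proof.
move=> sol abD wu; case/and5P: (sol) => a0 b0 z0 a_even /andP[/eqP abE _].
have abE' : a%:Z + b%:Z = c%:Z ^+ z by rewrite -PoszD abE PoszX.
have abD' : a%:Z * b%:Z = D%:Z * u%:Z ^+ 2 by rewrite -PoszM abD PoszM PoszX.
split=> /=.
- rewrite /qnorm /= wu [(2 * z)%N]mulnC exprM -abE'.
  transitivity ((b%:Z - a%:Z) ^+ 2 + 4 * (D%:Z * u%:Z ^+ 2)); first by ring.
  by rewrite -abD'; ring.
- apply/(coprimez_primes _ _ (ltnW c_gt1)) => q q_pr qc; apply/negP => q_diff.
  have [_ /negP qb _] := solution_coprime _ _ _ _ sol q_pr qc; apply: qb.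
  have : (q %| 2 * b%:Z)%Z.
    rewrite (_ : 2 * b%:Z = (b%:Z - a%:Z) + (a%:Z + b%:Z)); last by ring.
    by rewrite rpredD // abE' dvdz_exp.
  rewrite Euclid_dvdzM // => /orP[|//]; rewrite dvdzE /= dvdn_prime2 // => /eqP q2.
  by rewrite q2 dvdn2 c_odd in qc.
- rewrite -abE' (_ : _ - _ = - (2 * a%:Z)); last by ring.
  by rewrite rpredN dvdzE /=; lia.
Qed.

(** After multiplication by D u1, which is coprime to c, this is a computation from
    a + b = 0 modulo c for both solutions.  The sign e turns the second element
    into its conjugate when s and b1 a2 are opposite modulo c. *)
Lemma related_same_side a1 b1 z1 a2 b2 z2 (D u1 u2 : nat) (e : bool) :
  solution c U (a1, b1, z1) -> solution c U (a2, b2, z2) ->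
  (a1 * b1 = D * u1 ^ 2)%N ->
  (c %| (D * u1 * u2)%N%:Z - (-1) ^+ e * (b1 * a2)%N%:Z)%Z ->
  same_side c (b1%:Z - a1%:Z, u1%:Z) (b2%:Z - a2%:Z, (-1) ^+ e * u2%:Z).
Proof.
move=> sol1 sol2 abD1 side; rewrite /same_side /=.
case/and5P: (sol1) => a10 b10 z10 _ /andP[/eqP abE1 _].
case/and5P: (sol2) => a20 b20 z20 _ /andP[/eqP abE2 _].
have abE1' : a1%:Z + b1%:Z = c%:Z ^+ z1 by rewrite -PoszD abE1 PoszX.
have abE2' : a2%:Z + b2%:Z = c%:Z ^+ z2 by rewrite -PoszD abE2 PoszX.
have abD' : a1%:Z * b1%:Z = D%:Z * u1%:Z ^+ 2 by rewrite -PoszM abD1 PoszM PoszX.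
have co : coprimez c (D%:Z * u1%:Z).
  rewrite coprimez_sym; apply/(coprimez_primes _ _ (ltnW c_gt1)) => q q_pr qc.
  have [_ _] := solution_coprime _ _ _ _ sol1 q_pr qc; apply: contra.
  by rewrite abD1 -PoszM dvdzE /= => qDu; rewrite -mulnn mulnA dvdn_mulr.
rewrite -(Gauss_dvdzr _ co).
set S : int := (D * u1 * u2)%N%:Z in side.
have SE : S = D%:Z * u1%:Z * u2%:Z by rewrite /S !PoszM.
set sg : int := (-1) ^+ e in side *.
have sg2 : sg * sg = 1 by rewrite /sg; case: e {side sg}.
rewrite (_ : _ * _ = (b1%:Z - a1%:Z) * sg * (S - sg * (b1%:Z * a2%:Z))
   + b1%:Z * (c%:Z ^+ z1 * a2%:Z - a1%:Z * c%:Z ^+ z2)); last first.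
  transitivity ((b1%:Z - a1%:Z) * sg * S - (b2%:Z - a2%:Z) * (D%:Z * u1%:Z ^+ 2)).
    by rewrite SE; ring.
  rewrite -abD' -abE1' -abE2'.
  transitivity ((b1%:Z - a1%:Z) * sg * S - (sg * sg) * (b1%:Z - a1%:Z) * (b1%:Z * a2%:Z)
    + (b1%:Z - a1%:Z) * (b1%:Z * a2%:Z) - (b2%:Z - a2%:Z) * (a1%:Z * b1%:Z)).
    by rewrite sg2; ring.
  by ring.
rewrite -PoszM rpredD ?dvdz_mull // rpredB //; first by rewrite dvdz_mulr // dvdz_exp.
by rewrite dvdz_mull // dvdz_exp.
Qed.

Hypothesis U2 : 2%N \in U.

Lemma solution_exponent_eq a1 b1 z1 a2 b2 z2 :
  solution c U (a1, b1, z1) -> solution c U (a2, b2, z2) ->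
  z1 = z2 -> b1%:Z - a1%:Z = b2%:Z - a2%:Z -> (a1, b1, z1) = (a2, b2, z2).
Proof.
move=> /and5P[_ _ _ _ /andP[/eqP ab1 _]] /and5P[_ _ _ _ /andP[/eqP ab2 _]] z12 ab.
rewrite -z12 -ab1 in ab2; rewrite z12; congr (_, _, _); lia.
Qed.

(** The two lemmas below solve the case r = 3: the residues 1, 3, 9, 11 are those of
    the powers of 3 modulo 16, and they fix the signs of B - 3A and 3B - A. *)
Lemma cube_even_part (A B q : int) (T : nat) : A = 2 * q -> 0 < A -> 0 < B ->
  (T %% 16 \in [:: 1; 3; 9; 11])%N ->
  B - A - 2 * A = 1 \/ B - A - 2 * A = -1 ->
  B - A + 2 * B = T \/ B - A + 2 * B = - T%:Z ->
  B = 3 * A + 1 /\ T = 8 * A + 3 :> int.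
Proof. by rewrite !inE => AE A_gt0 B_gt0 T16 [F|F] [G|G]; split; lia. Qed.

Lemma cube_odd_part (A B q : int) (T : nat) : A = 2 * q -> 0 < A -> 0 < B ->
  (T %% 16 \in [:: 1; 3; 9; 11])%N -> ((A + B) %% 2)%Z = 1 ->
  B - A + 2 * B = 1 \/ B - A + 2 * B = -1 ->
  B - A - 2 * A = T \/ B - A - 2 * A = - T%:Z ->
  A = 3 * B + 1 /\ T = 8 * B + 3 :> int.
Proof. by rewrite !inE => AE A_gt0 B_gt0 T16 odd [F|F] [G|G]; split; lia. Qed.

(** Let delta = (sqrt B + sqrt (-A))^2.  All primes of ab divide D, hence AB.  For
    r = 2 one gets b = (B - A)^2, which is coprime to AB, so b = 1.  For odd r,
    a = A G^2 and b = B F^2, and the analysis of F and G applies. *)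
Lemma solution_power a b z j r (D : nat) d :
  (0 < D)%N -> (0 < j)%N -> z = (j * r)%N -> prime r ->
  solution c U (a, b, z) -> (forall p, p \in U -> (p %| D)%N) ->
  qrep (4 * D%:Z) c j d -> d.2 != 0 ->
  (qpow (4 * D%:Z) d r).1 = b%:Z - a%:Z ->
  special_square (a, b, z) \/ special_cube c (a, b, z).
Proof.
move=> D_gt0 j_gt0 zE r_pr sol UD d_rep d2 powE.
have supp p : prime p -> (p %| a)%N || (p %| b)%N -> (p %| D)%N.
  move=> p_pr; rewrite -Euclid_dvdM // (solution_support _ _ sol p_pr); exact: UD.
case/and5P: (sol) => a0 b0 z0 a_even /andP[/eqP abE _].
case: d d2 d_rep powE => x v /= v_neq0 [/= norm co_x mod4] powE.
(* A = -2q is even, because of the normalisation modulo 4 *)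
have [q qE] := dvdzP mod4.
pose P : int := c%:Z ^+ j.
have ABE : (- 2 * q) * (P + 2 * q) = D%:Z * v ^+ 2.
  apply: (@mulfI _ 4) => //.
  transitivity (P ^+ 2 - (q * 4 + P) ^+ 2); first by ring.
  rewrite -qE /P subrK -exprM mulnC -norm /qnorm /=; ring.
have P_gt0 : 0 < P by rewrite exprn_gt0 // ltz_nat ltnW.
have v2 : 0 < v ^+ 2 by rewrite exprn_even_gt0.
have AB_gt0 : 0 < (- 2 * q) * (P + 2 * q) by rewrite ABE mulr_gt0.
have [A_gt0 B_gt0] : 0 < - 2 * q /\ 0 < P + 2 * q.
  by move: AB_gt0 P_gt0; clear; move: P => P; nia.
set A := - 2 * q in A_gt0 AB_gt0 ABE; set B := P + 2 * q in B_gt0 AB_gt0 ABE.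
have ABP : A + B = P by rewrite /A /B; ring.
have xE : x = B - A by rewrite -[x](subrK (c%:Z ^+ j)) qE -/P /A /B; ring.
have co : coprimez A B.
  rewrite -[B]gez0_abs ?(ltW B_gt0) //; apply/coprimez_primes.
    by rewrite absz_gt0 gt_eqF.
  move=> p p_pr pB; apply/negP => pA; have {}pB : (p %| B)%Z by rewrite dvdzE.
  have pc : (p %| c)%N.
    have : (p %| c%:Z)%Z by apply: (@prime_dvdzX p j) => //; rewrite -/P -ABP rpredD.
    by rewrite dvdzE.
  have /(coprimez_primes _ _ (ltnW c_gt1))/(_ p p_pr pc)/negP := co_x; apply.
  by rewrite xE rpredB.
have abP : a%:Z + b%:Z = (A + B) ^+ r by rewrite ABP /P -exprM -zE -PoszX -abE.
have suppAB p : prime p -> (p %| a)%N || (p %| b)%N -> (p %| A * B)%Z.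
  by move=> p_pr /(supp p p_pr) pD; rewrite ABE dvdz_mulr // dvdzE.
rewrite xE in powE.
case: (even_prime r_pr) => [r2|r_odd].
  left; split=> /=; last by exists j; rewrite zE r2 mulnC.
  have bE : b%:Z = (B - A) ^+ 2.
    move: powE abP; rewrite r2 qpowS qpow1 /qmul /= => powE abP.
    have : 4 * D%:Z * (v * v) = 4 * (A * B) by rewrite ABE; ring.
    by move=> vE; rewrite vE in powE; lia.
  have bE' : b = (`|B - A| ^ 2)%N by rewrite -abszX -bE.
  suff n1 : (`|B - A| = 1)%N by rewrite bE' n1.
  apply/eqP; apply: contraT => n_neq1.
  have n_gt1 : (1 < `|B - A|)%N.
    by move: b0 n_neq1; rewrite bE'; case: (absz _) => [|[|n]].
  have p_pr := pdiv_prime n_gt1; set p := pdiv _ in p_pr.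
  have p_diff : (p %| B - A)%Z by rewrite dvdzE pdiv_dvd.
  have : (p %| A * B)%Z.
    by apply: suppAB => //; rewrite bE' dvdn_exp ?orbT // pdiv_dvd.
  rewrite Euclid_dvdzM // => /orP[pA|pB].
    case: (coprimez_prime _ _ _ p_pr co pA).
    by rewrite -(subrK A B) rpredD.
  case: (coprimez_prime _ _ _ p_pr co _ pB).
  by rewrite -[A](subKr B) rpredB.
right; pose m := r./2; have rE : r = (2 * m + 1)%N by rewrite /m; lia.
have m_gt0 : (0 < m)%N by have := odd_prime_gt2 r_odd r_pr; lia.
move: powE abP; rewrite rE (qpow_odd _ _ _ _ _ ABE) -odd_parts_norm /= => powE abP.
have bF : b%:Z = B * (odd_parts A B m).1 ^+ 2 by lia.
have aG : a%:Z = A * (odd_parts A B m).2 ^+ 2 by lia.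
have F_neq0 : (odd_parts A B m).1 != 0.
  by apply: contraTneq b0 => F0; move: bF; rewrite F0 expr0n mulr0 => -[->].
have G_neq0 : (odd_parts A B m).2 != 0.
  by apply: contraTneq a0 => G0; move: aG; rewrite G0 expr0n mulr0 => -[->].
have AB_ge3 : 3 <= A + B.
  rewrite ABP; apply: (@le_trans _ _ c%:Z); first by rewrite lez_nat; lia.
  by rewrite /P -PoszX lez_nat -{1}(expn1 c) leq_exp2l.
have r_pr' : prime (2 * m + 1) by rewrite -rE.
have suppF p : prime p -> (p %| (odd_parts A B m).1)%Z -> (p %| A * B)%Z.
  move=> p_pr pF; apply: suppAB => //; apply/orP; right.
  by have : (p %| b%:Z)%Z by rewrite bF dvdz_mull // expr2 dvdz_mull.
have suppG p : prime p -> (p %| (odd_parts A B m).2)%Z -> (p %| A * B)%Z.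
  move=> p_pr pG; apply: suppAB => //; apply/orP; left.
  by have : (p %| a%:Z)%Z by rewrite aG dvdz_mull // expr2 dvdz_mull.
have [m1 [s sP]] := odd_parts_cube A B m A_gt0 B_gt0 AB_ge3 co r_pr' m_gt0 F_neq0
  G_neq0 suppF suppG.
have zE' : z = (3 * j)%N by rewrite zE rE m1 mulnC.
clear suppF suppG suppAB supp; move: bF aG sP; rewrite m1 /= !mulr1.
set F := B - A - 2 * A; set G := B - A + 2 * B => bF aG sP.
have P_odd : (P %% 2)%Z = 1 by have := oddX c j; rewrite c_odd orbT /P -PoszX; clear; lia.
have s16 : ((3 ^ s) %% 16 \in [:: 1; 3; 9; 11])%N.
  elim: s {sP} => // s; rewrite expnS -modnMmr !inE.
  by move=> /or4P[]/eqP->.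
case: sP => -[S1 S2].
  have SF : F = 1 \/ F = -1 by move/eqP: S1; rewrite sqrf_eq1 => /orP[]/eqP->; auto.
  have SG : G = (3 ^ s)%N \/ G = - (3 ^ s)%N%:Z.
    by move/eqP: S2; rewrite eqf_sqr => /orP[]/eqP->; auto.
  have AE : A = `|A|%N by rewrite gez0_abs // ltW.
  exists j, `|A|%N, s.
  have [BE TE] : B = 3 * A + 1 /\ (3 ^ s)%N = 8 * A + 3 :> int.
    by apply: (cube_even_part A B (- q)) => //; rewrite /A; ring.
  split=> //.
  - by rewrite absz_gt0 gt_eqF.
  - by move: ABP; rewrite BE /P -PoszX; clear -A_gt0; lia.
  - by clear -TE A_gt0; lia.
  left; congr (_, _).
    by apply/eqP; rewrite -eqz_nat PoszM PoszX -AE aG S2.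
  by apply/eqP; rewrite -eqz_nat bF S1 BE mulr1 PoszD PoszM -AE.
have SG : G = 1 \/ G = -1 by move/eqP: S1; rewrite sqrf_eq1 => /orP[]/eqP->; auto.
have SF : F = (3 ^ s)%N \/ F = - (3 ^ s)%N%:Z.
  by move/eqP: S2; rewrite eqf_sqr => /orP[]/eqP->; auto.
have BE : B = `|B|%N by rewrite gez0_abs // ltW.
exists j, `|B|%N, s.
have [AE TE] : A = 3 * B + 1 /\ (3 ^ s)%N = 8 * B + 3 :> int.
  by apply: (cube_odd_part A B (- q)) => //; rewrite ?ABP // /A; ring.
split=> //.
- by rewrite absz_gt0 gt_eqF.
- by move: ABP; rewrite AE /P -PoszX; clear -B_gt0; lia.
- by clear -TE B_gt0; lia.
right; congr (_, _).
  by apply/eqP; rewrite -eqz_nat aG S1 AE mulr1 PoszD PoszM -BE.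
by apply/eqP; rewrite -eqz_nat PoszM PoszX -BE bF S2.
Qed.

(** Taking D = gcd(ab, a'b') makes both products D times a square, and every prime
    of U divides D.  The two elements of Z[sqrt (-4D)] lie on the same side of c;
    if the exponents agree they are equal, and otherwise the one of larger exponent
    is an r-th power. *)
Lemma related_special t t' : solution c U t -> solution c U t' ->
  related c t t' -> (t.2 <= t'.2)%N -> t != t' ->
  special_square t' \/ special_cube c t'.
Proof.
case: t => [[a1 b1] z1]; case: t' => [[a2 b2] z2] sol1 sol2 [s [/= sE sc]] /= z12 neq.
case/and5P: (sol1) => a10 b10 z10 _ /andP[/eqP abE1 _].
case/and5P: (sol2) => a20 b20 z20 _ /andP[/eqP abE2 _].
have t1_gt0 : (0 < a1 * b1)%N by rewrite muln_gt0 a10.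
have t2_gt0 : (0 < a2 * b2)%N by rewrite muln_gt0 a20.
have [u1 [u2 [t1E t2E sE']]] := common_square_class _ _ _ t1_gt0 t2_gt0 sE.
set D := gcdn _ _ in t1E t2E sE'.
have UD p : p \in U -> (p %| D)%N.
  move=> pU; have p_pr : prime p.
    move: pU; case/and5P: sol1 => _ _ _ _ /andP[_ /eqP <-].
    by rewrite mem_primes => /and3P[].
  by rewrite dvdn_gcd (solution_support _ _ sol1 p_pr) (solution_support _ _ sol2 p_pr) pU.
have D_gt0 : (0 < D)%N by rewrite gcdn_gt0 t1_gt0.
have D2 := UD 2 U2.
have E_gt4 : 4 < 4 * D%:Z by have := dvdn_leq D_gt0 D2; lia.
have E4 : (4 %| 4 * D%:Z)%Z by rewrite dvdz_mulr.
have cE : coprimez (4 * D%:Z) c.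
  apply/(coprimez_primes _ _ (ltnW c_gt1)) => q q_pr qc; rewrite Euclid_dvdzM // negb_or.
  apply/andP; split.
    have : ~~ (q %| (2 * 2 : int))%Z; last by [].
    rewrite Euclid_dvdzM // orbb dvdzE /= dvdn_prime2 //.
    by apply/negP => /eqP q2; rewrite q2 dvdn2 c_odd in qc.
  have [_ _] := solution_coprime _ _ _ _ sol1 q_pr qc; apply: contra.
  by rewrite dvdzE /= t1E => qD; rewrite dvdn_mulr.
have [e side] : exists e : bool, (c %| (D * u1 * u2)%N%:Z - (-1) ^+ e * (b1 * a2)%N%:Z)%Z.
  case/orP: sc => h; rewrite -sE'; [exists false | exists true].
    by rewrite expr0 mul1r.
  by rewrite expr1 mulN1r opprK.
have := related_same_side _ _ _ _ _ _ _ _ _ _ sol1 sol2 t1E side.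
set w2 : int := (-1) ^+ e * u2%:Z => gh.
have rep1 := solution_qrep _ _ _ _ _ u1%:Z sol1 t1E erefl.
have rep2 : qrep (4 * D%:Z) c z2 (b2%:Z - a2%:Z, w2).
  by apply: solution_qrep sol2 t2E _; rewrite exprMn sqrr_sign mul1r.
move: z12; rewrite leq_eqVlt => /orP[/eqP z12|z12].
  have zz : (0 < z1 <= z2)%N by rewrite z10 z12 leqnn.
  have [d [dE d_rep _]] := qrep_div _ _ E_gt4 E4 c_odd c_gt1 cE _ _ _ _ zz rep1 rep2 gh.
  have d1 : d = (1, 0).
    apply: (qrep_norm1 _ c E_gt4).
    by move: d_rep; rewrite z12 subnn.
  case/negP: neq; apply/eqP; apply: (solution_exponent_eq _ _ _ _ _ _) => //.
  by move: dE; rewrite d1 qmul1 => -[].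
have zz : (0 < z1 < z2)%N by rewrite z10.
have [r [j [d [r_pr zE j_gt0 d_rep dE]]]] :=
  qrep_prime_root _ _ E_gt4 E4 c_odd c_gt1 cE _ _ _ _ zz rep1 rep2 gh.
apply: (solution_power a2 b2 z2 j r D d) => //; last by rewrite -dE.
apply/eqP => d2; move: dE; case: d d2 {d_rep} => x v /= -> /(congr1 snd).
rewrite qpow_w0 /= /w2 => /eqP; rewrite mulf_eq0 signr_eq0 /= => /eqP -[] u20.
by rewrite t2E u20 muln0 in t2_gt0.
Qed.
End KeyLemma.

(** * Uniqueness of the exceptional solution *)

Lemma special_cube_support (m e p : nat) : prime p -> (3 ^ e = 8 * m + 3)%N ->
  (0 < m)%N ->
  (p %| m * (3 ^ e) ^ 2 * (3 * m + 1))%N = (p %| m * (3 * m + 1))%N.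
Proof.
move=> p_pr eE m_gt0; rewrite Euclid_dvdM // [RHS]Euclid_dvdM //; congr (_ || _).
rewrite Euclid_dvdM //.
apply/idP/idP => [/orP[//|]|->//]; rewrite -expnM Euclid_dvdX // dvdn_prime2 //.
have m3 : (3 %| m)%N.
  by case: e eE => [|e]; rewrite ?expn0 ?expnS; lia.
by case/andP => /eqP->.
Qed.

Section SpecialUnique.
Variables (c : nat) (U : seq nat).
Hypotheses (c_odd : odd c) (c_gt1 : (1 < c)%N).

Lemma special_squareP t : solution c U t -> special_square t -> exists j,
  [/\ (0 < j)%N, t = (c ^ (2 * j) - 1, 1, 2 * j)%N &
     forall p, prime p -> (p %| c ^ (2 * j) - 1)%N = (p \in U)].
Proof.
case: t => [[a b] z] sol [/= b1 [j zE]]; subst b z; exists j.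
have aE : (a = c ^ (2 * j) - 1)%N.
  by case/and5P: sol => _ _ _ _ /andP[/eqP <- _]; rewrite addnK.
split; first by case/and5P: sol => _ _ + _ _; rewrite muln_gt0.
  by rewrite {1}aE.
by move=> p p_pr; rewrite -aE -(solution_support _ _ _ _ sol p_pr) /= muln1.
Qed.

(** As a is even, the parity of m decides which of the two orders occurs. *)
Lemma special_cubeP t : solution c U t -> special_cube c t -> exists k m e,
  [/\ [/\ (0 < m)%N, (c ^ k = 4 * m + 1)%N & (3 ^ e = 8 * m + 3)%N],
     t = (if odd m then (3 * m + 1, m * (3 ^ e) ^ 2, 3 * k)
          else (m * (3 ^ e) ^ 2, 3 * m + 1, 3 * k))%N &
     forall p, prime p -> (p %| m * (3 * m + 1))%N = (p \in U)].
Proof.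
case: t => [[a b] z] sol [k [m [e [m_gt0 ckE eE /= zE abE]]]].
exists k, m, e; split=> //; last first.
  move=> p p_pr; rewrite -(solution_support _ _ _ _ sol p_pr).
  rewrite -(special_cube_support m e p) //=.
  by case: abE => -[-> ->] //; rewrite mulnC.
case/and5P: sol => _ _ _ a_even _; rewrite zE.
by case: abE a_even => -[-> ->]; rewrite ?oddM ?oddX ?oddD ?oddM /=;
  case: (odd m); rewrite ?orbT ?andbT.
Qed.

Lemma special_unique t t' : solution c U t -> solution c U t' ->
  special_square t \/ special_cube c t -> special_square t' \/ special_cube c t' ->
  t = t'.
Proof.
have c2_mod4 := sqrn_mod4 c c_odd.
have c2_gt1 : (1 < c ^ 2)%N by rewrite -(exp1n 2) ltn_exp2r.
move=> sol sol' [sp|sp] [sp'|sp'].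
- have [j [j0 -> supp]] := special_squareP t sol sp.
  have [j' [j'0 -> supp']] := special_squareP t' sol' sp'.
  have dvd i i' : (0 < i)%N -> (0 < i')%N ->
      (forall p, prime p -> (p %| c ^ (2 * i) - 1)%N = (p \in U)) ->
      (forall p, prime p -> (p %| c ^ (2 * i') - 1)%N = (p \in U)) -> (i %| i')%N.
    move=> i0 i'0 s s'; apply: (@expn_subr1_support (c ^ 2)) => // p p_pr.
    by rewrite -!expnM s // s'.
  suff -> : j = j' by [].
  by apply/eqP; rewrite eqn_dvd !dvd.
- have [j [j0 _ supp]] := special_squareP t sol sp.
  have [k [m [e [[m0 ckE eE] _ supp']]]] := special_cubeP t' sol' sp'.
  case: (special_types_disjoint c j k m e) => // p p_pr.
  by rewrite supp // supp'.
- have [j [j0 _ supp]] := special_squareP t' sol' sp'.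
  have [k [m [e [[m0 ckE eE] _ supp']]]] := special_cubeP t sol sp.
  case: (special_types_disjoint c j k m e) => // p p_pr.
  by rewrite supp // supp'.
have [k [m [e [[m0 ckE eE] -> supp]]]] := special_cubeP t sol sp.
have [k' [m' [e' [[m'0 ck'E e'E] -> supp']]]] := special_cubeP t' sol' sp'.
case: (ltngtP k k') => [lt|lt|kk'].
- case: (special_cubes_unique c k k' m m' e e') => // p p_pr.
  by rewrite supp // supp'.
- case: (special_cubes_unique c k' k m' m e' e) => // p p_pr.
  by rewrite supp // supp'.
have mm' : m = m' by move: ck'E; rewrite -kk' ckE; clear; lia.
by rewrite -mm' in e'E *; rewrite eE e'E kk'.
Qed.
End SpecialUnique.

(** * Counting classes of exponent vectors *)

Lemma mod_half_inj (e x y : nat) : (x < 2 * e)%N -> (y < 2 * e)%N ->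
  (x %% e = y %% e)%N -> (e <= x)%N = (e <= y)%N -> x = y.
Proof.
move=> x_lt y_lt; case: (leqP e x) => ex; case: (leqP e y) => ey // xy _; last first.
  by rewrite !modn_small in xy.
move: xy; rewrite -(subnK ex) -(subnK ey) !modnDr !modn_small; lia.
Qed.

Lemma natZp_eq (c m n : nat) : (1 < c)%N ->
  ((m%:R : 'Z_c) == n%:R) = (m == n %[mod c]).
Proof. by move=> c_gt1; rewrite -val_eqE /= !val_Zp_nat. Qed.

Lemma prod_logn (U : seq nat) (a : nat) : (0 < a)%N -> uniq U ->
  (forall p, prime p -> (p %| a)%N -> p \in U) ->
  a = (\prod_(i < size U) nth 0%N U i ^ logn (nth 0%N U i) a)%N.
Proof.
move=> a_gt0 U_uniq supp.
rewrite [LHS]prod_prime_decomp // prime_decompE big_map /=.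
rewrite -(big_mkord xpredT (fun i => nth 0%N U i ^ logn (nth 0%N U i) a)%N).
rewrite -(big_nth 0%N xpredT (fun p => p ^ logn p a)%N).
rewrite [RHS](bigID (mem (primes a))) /= [X in (_ * X)%N]big1 ?muln1; last first.
  by move=> p; rewrite -logn_gt0 lt0n negbK => /eqP->.
rewrite -[RHS]big_filter; apply: perm_big; apply: uniq_perm.
- exact: primes_uniq.
- exact: filter_uniq.
move=> p; rewrite mem_filter; apply/idP/andP => [pa|[]//]; split=> //.
by move: pa; rewrite mem_primes => /and3P[p_pr _]; apply: supp.
Qed.

Section Pigeonhole.
Variables (c : nat) (U : seq nat).
Hypotheses (c_odd : odd c) (c_gt1 : (1 < c)%N).
Hypothesis (cU : forall p, p \in U -> ~~ (p %| c)%N).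
Hypothesis (U_prime : forall p, p \in U -> prime p).
Hypothesis (U_uniq : uniq U).

(* Exponents modulo N = 2e: parity makes sense, and half an exponent is defined
   modulo e, which is enough to raise units modulo c to that power. *)
Let e := totient c.
Let N := (2 * e)%N.
Let p_ (i : 'I_(size U)) : 'Z_c := (nth 0%N U i)%:R.

Let e_gt0 : (0 < e)%N. Proof. by rewrite totient_gt0 ltnW. Qed.
Let N_gt1 : (1 < N)%N. Proof. by rewrite /N; lia. Qed.

Definition expvec := {ffun 'I_(size U) -> 'Z_N}.

Definition chi (v : expvec) : 'Z_c := \prod_i p_ i ^+ (v i).

Lemma p_e i : p_ i ^+ e = 1.
Proof.
have iU : nth 0%N U i \in U by rewrite mem_nth.
rewrite /p_ -natrX; apply/eqP; rewrite (natZp_eq _ _ 1) //; apply/eqP.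
by apply: Euler_exp_totient; rewrite prime_coprime ?U_prime ?cU.
Qed.

Lemma p_mod i m n : m = n %[mod e] -> p_ i ^+ m = p_ i ^+ n.
Proof. by move=> mn; rewrite -(expr_mod m (p_e i)) mn expr_mod // p_e. Qed.

Lemma p_modN i m n : m = n %[mod N] -> p_ i ^+ m = p_ i ^+ n.
Proof.
move=> mn; apply: p_mod; have eN : (e %| N)%N by rewrite /N dvdn_mull.
by rewrite -(modn_dvdm _ eN) mn modn_dvdm.
Qed.

Lemma chiD v w : chi (v + w) = chi v * chi w.
Proof.
rewrite /chi -big_split /=; apply: eq_bigr => i _; rewrite ffunE -exprD.
apply: p_modN; rewrite -[v i + w i](_ : ((v i + w i)%N)%:R = _); last first.
  by rewrite natrD !natr_Zp.
by rewrite val_Zp_nat // modn_mod.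
Qed.

Lemma chi_nat (f : 'I_(size U) -> nat) :
  chi [ffun i => (f i)%:R] = \prod_i p_ i ^+ f i.
Proof.
apply: eq_bigr => i _; rewrite ffunE; apply: p_modN.
by rewrite val_Zp_nat // modn_mod.
Qed.

Lemma chi_nat_logn (a : nat) : (0 < a)%N ->
  (forall p, prime p -> (p %| a)%N -> p \in U) ->
  \prod_i p_ i ^+ logn (nth 0%N U i) a = a%:R.
Proof.
move=> a_gt0 supp; rewrite {2}(prod_logn U a a_gt0 U_uniq supp) natr_prod.
by apply: eq_bigr => i _; rewrite natrX.
Qed.

(** The exponent vector of a/b. *)
Definition solvec (t : nat * nat * nat) : expvec :=
  [ffun i : 'I_(size U) => (logn (nth 0%N U i) t.1.1)%:R - (logn (nth 0%N U i) t.1.2)%:R].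

Lemma solution_supp t : solution c U t ->
  [/\ (0 < t.1.1)%N, (0 < t.1.2)%N, forall p, prime p -> (p %| t.1.1)%N -> p \in U &
      forall p, prime p -> (p %| t.1.2)%N -> p \in U].
Proof.
case: t => [[a b] z] sol; case/and5P: (sol) => a0 b0 _ _ _; split=> //= p p_pr pd.
  by rewrite -(solution_support _ _ _ _ sol p_pr) dvdn_mulr.
by rewrite -(solution_support _ _ _ _ sol p_pr) dvdn_mull.
Qed.

Lemma p_unit_prod (f : 'I_(size U) -> nat) : \prod_i p_ i ^+ f i \is a GRing.unit.
Proof.
apply: rpred_prod => i _; apply: rpredX; rewrite unitZpE //.
have iU : nth 0%N U i \in U by rewrite mem_nth.
by rewrite coprime_sym prime_coprime ?U_prime ?cU.
Qed.

Lemma chi_solvec t : solution c U t -> chi (solvec t) = -1.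
Proof.
move=> sol; have [a0 b0 suppa suppb] := solution_supp t sol.
case: t sol a0 b0 suppa suppb => [[a b] z] sol /= a0 b0 suppa suppb.
have bu := p_unit_prod (fun i => logn (nth 0%N U i) b).
apply: (mulIr bu); rewrite -{1}chi_nat -chiD mulN1r chi_nat_logn //.
transitivity (chi [ffun i : 'I_(size U) => (logn (nth 0%N U i) a)%:R]).
  by congr chi; apply/ffunP => i; rewrite !ffunE /= subrK.
rewrite chi_nat chi_nat_logn //; apply/eqP; rewrite -addr_eq0 -natrD.
case/and5P: sol => _ _ z0 _ /andP[/eqP -> _].
rewrite (natZp_eq _ _ 0) // mod0n -/(dvdn _ _).
by rewrite -{1}(expn1 c) dvdn_exp2l.
Qed.

(** In nat, a negative exponent is avoided by halving the exponents of a b a' b'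
    instead of those of a b' / (b a'); the quotient of the two halves is b a'. *)
Lemma related_of_solvec t t' (y : expvec) : solution c U t -> solution c U t' ->
  (chi y == 1) || (chi y == -1) -> solvec t = solvec t' + (y + y) ->
  related c t t'.
Proof.
move=> sol sol' chi_y vecE.
have [a0 b0 suppa suppb] := solution_supp t sol.
have [a'0 b'0 suppa' suppb'] := solution_supp t' sol'.
rewrite /related.
case: t sol vecE a0 b0 suppa suppb => [[a b] z] sol vecE /= a0 b0 suppa suppb.
case: t' sol' vecE a'0 b'0 suppa' suppb' => [[a' b'] z'] sol' vecE /= a'0 b'0 suppa' suppb'.
pose l n (i : 'I_(size U)) := logn (nth 0%N U i) n.
pose S i := (l a i + l b i + (l a' i + l b' i))%N.
have SE i : S i = (2 * (l b i + l a' i + y i))%N %[mod N].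
  apply/eqP; rewrite -natZp_eq // /S !natrM !natrD natr_Zp.
  have := congr1 (fun v : expvec => v i) vecE; rewrite !ffunE /= -!/(l _ _) => E.
  rewrite -[(l a i)%:R](subrK (l b i)%:R) E; apply/eqP; ring.
have S_even i : S i = (2 * (S i)./2)%N.
  have : (2 %| S i)%N.
    have N2 : (2 %| N)%N by rewrite /N dvdn_mulr.
    by rewrite /dvdn -(modn_dvdm _ N2) SE modn_dvdm // modnMr.
  by rewrite dvdn2; lia.
have halfE i : (S i)./2 = (l b i + l a' i + y i)%N %[mod e].
  apply/eqP; rewrite -(eqn_pmul2l (isT : (0 < 2)%N)) !muln_modr -/N -S_even.
  by apply/eqP.
pose s := (\prod_(i < size U) nth 0%N U i ^ (S i)./2)%N.
have prodE n : (0 < n)%N -> (forall p, prime p -> (p %| n)%N -> p \in U) ->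
    (\prod_(i < size U) nth 0%N U i ^ l n i = n)%N.
  by move=> n0 supp; rewrite [RHS](prod_logn U n n0 U_uniq supp).
exists s; split.
  rewrite -[a]prodE // -[b]prodE // -[a']prodE // -[b']prodE //.
  rewrite -!big_split /= -mulnn /s -big_split /=; apply: eq_bigr => i _.
  by rewrite -!expnD addnn -mul2n -S_even.
have sE : (s%:R : 'Z_c) = b%:R * a'%:R * chi y.
  rewrite natr_prod -!chi_nat_logn // -!big_split /=.
  by apply: eq_bigr => i _; rewrite natrX -!exprD; apply: p_mod; apply: halfE.
case/orP: chi_y => /eqP chi_y; apply/orP; rewrite chi_y in sE.
  left; move/eqP: sE; rewrite mulr1 -natrM natZp_eq // => sE.
  by rewrite -eqz_mod_dvd !modz_nat; apply/eqP; congr Posz; apply/eqP.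
right; move/eqP: sE; rewrite mulrN1 -addr_eq0 -natrM -natrD (natZp_eq _ _ 0) // mod0n.
by rewrite -PoszD dvdzE.
Qed.

(** Let K be the set of vectors v with chi v = 1 or -1, and Km the part with -1.
    The map sending (t, w) with w in K to solvec t + 2w in Km is injective once the
    half of Z/N in which each coordinate of w lies is recorded; so
    |L| |K| <= |Km| 2^n with n = |U|.  Translation by the vector of a solution shows
    2 |Km| <= |K|. *)
Lemma solutions_card (L : seq (nat * nat * nat)) : uniq L ->
  {in L, forall t, solution c U t} ->
  {in L &, forall t t', related c t t' -> t = t'} ->
  (2 * size L <= 2 ^ size U)%N.
Proof.
move=> L_uniq sol unrel.
case: L => [|t0 L'] in L_uniq sol unrel *; first by rewrite muln0.
set L := t0 :: L' in L_uniq sol unrel *.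
pose K := [set v : expvec | (chi v == 1) || (chi v == -1)]%SET.
pose Km := [set v : expvec | chi v == -1]%SET.
pose Kp := [set v : expvec | chi v == 1]%SET.
have v0_Km : solvec t0 \in Km by rewrite inE chi_solvec // sol ?mem_head.
have KpmK : (#|K| = #|Kp| + #|Km|)%N.
  have -> : K = (Kp :|: Km)%SET by apply/setP => v; rewrite !inE.
  rewrite cardsU (_ : Kp :&: Km = finset.set0)%SET ?cards0 ?subn0 //.
  apply/setP => v; rewrite !inE; apply/negP => /andP[/eqP-> ].
  rewrite -addr_eq0 -(natrD _ 1 1) (natZp_eq _ _ 0) // mod0n -/(dvdn _ _).
  move=> c2; have := dvdn_leq (isT : 0 < 2)%N c2.
  by case: (c) c_odd c_gt1 => [|[|[|]]].
have Km_le : (#|Km| <= #|Kp|)%N.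
  rewrite -(card_imset Km (addIr (solvec t0))); apply: subset_leq_card.
  apply/fintype.subsetP => _ /imsetP[v vK ->]; rewrite inE chiD.
  by move: vK v0_Km; rewrite !inE => /eqP-> /eqP->; rewrite mulrNN mulr1.
pose half (w : expvec) : {ffun 'I_(size U) -> bool} := [ffun i => (e <= w i)%N].
pose f (x : 'I_(size L) * expvec) := (solvec (nth t0 L x.1) + (x.2 + x.2), half x.2).
have f_inj : {in finset.setX [set: 'I_(size L)]%SET K &, injective f}.
  move=> [i w] [j w']; rewrite !finset.in_setX !finset.in_setT /= => wK w'K [vecE halfE].
  have solL (k : 'I_(size L)) : solution c U (nth t0 L k).
    by apply: sol; rewrite mem_nth.
  have yK : (chi (w' - w) == 1) || (chi (w' - w) == -1).
    have E : chi w' = chi (w' - w) * chi w by rewrite -chiD subrK.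
    move: wK w'K; rewrite !inE E.
    by case/orP=> /eqP->; rewrite ?mulr1 // mulrN1 eqr_oppLR eqr_opp orbC.
  have rel : related c (nth t0 L i) (nth t0 L j).
    apply: (related_of_solvec _ _ _ (solL i) (solL j) yK).
    rewrite -[LHS](addrK (w + w)) vecE -addrA; congr (_ + _).
    by rewrite addrACA opprD.
  have ij : i = j.
    apply/val_inj/eqP; rewrite -(nth_uniq t0 (ltn_ord i) (ltn_ord j) L_uniq); apply/eqP.
    by apply: unrel rel; rewrite mem_nth.
  rewrite ij; congr (_, _); apply/ffunP => k; apply: val_inj => /=.
  have wE : w + w = w' + w' by move: vecE; rewrite ij; apply: addrI.
  have /eqP : ((2 * w k)%N%:R : 'Z_N) = (2 * w' k)%N%:R.
    have := congr1 (fun v : expvec => v k) wE; rewrite !ffunE => E.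
    by rewrite !mul2n -!addnn !natrD !natr_Zp.
  rewrite natZp_eq // -!muln_modr eqn_pmul2l // => /eqP modE.
  have := congr1 (fun v : {ffun _ -> bool} => v k) halfE; rewrite !ffunE.
  have lt_N (x : 'Z_N) : (x < N)%N.
    by rewrite -[X in (_ < X)%N](Zp_cast N_gt1) ltn_ord.
  exact: (mod_half_inj _ _ _ (lt_N _) (lt_N _) modE).
have f_sub : (f @: finset.setX [set: 'I_(size L)] K \subset
     finset.setX Km [set: {ffun 'I_(size U) -> bool}])%SET.
  apply/fintype.subsetP => _ /imsetP[[i w] iwK ->].
  move: iwK; rewrite !finset.in_setX !finset.in_setT /= andbT => wK.
  rewrite inE !chiD chi_solvec ?sol ?mem_nth //.
  by move: wK; rewrite inE => /orP[]/eqP->; rewrite ?mulrNN !mulr1.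
have := subset_leq_card f_sub; rewrite card_in_imset // !cardsX !cardsT card_ord.
rewrite card_ffun card_bool card_ord KpmK.
have Km_gt0 : (0 < #|Km|)%N by apply/card_gt0P; exists (solvec t0).
move=> le; rewrite -(leq_pmul2l Km_gt0); apply: leq_trans le.
by rewrite mul2n -addnn mulnC mulnDl -mulnDr leq_mul2l leq_add2r Km_le orbT.
Qed.
End Pigeonhole.

(** * Summing over the prime supports *)

(** a + b = a' + b' = 0 modulo c gives b a' = b' a modulo c. *)
Lemma related_sym (c : nat) (U : seq nat) t t' : solution c U t -> solution c U t' ->
  related c t t' -> related c t' t.
Proof.
case: t => [[a b] z]; case: t' => [[a' b'] z'] sol sol' [s [/= sE sc]].
exists s; split=> /=; first by rewrite sE mulnC.
case/and5P: sol => _ _ z0 _ /andP[/eqP abE _].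
case/and5P: sol' => _ _ z'0 _ /andP[/eqP abE' _].
have aE : a%:Z + b%:Z = c%:Z ^+ z by rewrite -PoszD abE PoszX.
have aE' : a'%:Z + b'%:Z = c%:Z ^+ z' by rewrite -PoszD abE' PoszX.
have dvd : (c %| (b * a')%N%:Z - (b' * a)%N%:Z)%Z.
  rewrite (_ : _ - _ = c%:Z ^+ z * a'%:Z - c%:Z ^+ z' * a%:Z); last first.
    by rewrite -aE -aE' !PoszM; ring.
  by rewrite rpredB // dvdz_mulr // dvdz_exp.
case/orP: sc => sc; apply/orP; [left|right].
  by have := rpredD sc dvd; rewrite addrA subrK.
by have := rpredB sc dvd; rewrite opprB addrA addrAC addrK.
Qed.

(** Among the solutions that are not special no two are related, and there is at most
    one special solution. *)
Lemma solutions_size (c : nat) (U : seq nat) (L : seq (nat * nat * nat)) :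
  odd c -> (1 < c)%N -> (forall p, p \in U -> ~~ (p %| c)%N) -> 2%N \in U ->
  uniq L -> {in L, forall t, solution c U t} ->
  (size L <= 2 ^ (size U).-1 + 1)%N.
Proof.
move=> c_odd c_gt1 cU U2 L_uniq sol.
case: L => [//|t0 L'] in L_uniq sol *; set L := t0 :: L' in L_uniq sol *.
have UE : exists n, U = primes n.
  case: (t0) (sol t0 (mem_head _ _)) => [[a b] z] /and5P[_ _ _ _ /andP[_ /eqP <-]].
  by exists (a * b)%N.
have U_prime p : p \in U -> prime p.
  by case: UE => n ->; rewrite mem_primes => /and3P[].
have U_uniq : uniq U by case: UE => n ->; apply: primes_uniq.
pose sp t := `[< special_square t \/ special_cube c t >].
rewrite -(count_predC sp) -!size_filter addnC leq_add //; last first.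
  case E : [seq t <- L | sp t] => [|t [|t' M]] //.
  have uM : uniq [:: t, t' & M] by rewrite -E filter_uniq.
  have mem x : x \in [:: t, t' & M] -> solution c U x /\ sp x.
    by rewrite -E mem_filter => /andP[spx xL]; split=> //; apply: sol.
  have [solt spt] := mem t (mem_head _ _).
  have [|solt' spt'] := mem t'; first by rewrite !inE eqxx orbT.
  have tt' := special_unique c U c_odd c_gt1 t t' solt solt' (asboolW spt) (asboolW spt').
  by move: uM; rewrite tt' /= mem_head.
have U_gt0 : (0 < size U)%N by case: (U) U2.
rewrite -(leq_pmul2l (isT : 0 < 2)%N) -expnS prednK //.
apply: (solutions_card c U) => //; first exact: filter_uniq.
  by move=> t; rewrite mem_filter => /andP[_]; apply: sol.
move=> t t'; rewrite !mem_filter /= => /andP[nt tL] /andP[nt' t'L] rel.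
apply/eqP; apply: contraT => neq.
have [le|lt] := leqP t.2 t'.2.
  case/negP: nt'; apply/asboolP.
  exact: (related_special c U c_odd c_gt1 cU U2 t t' (sol t tL) (sol t' t'L)).
case/negP: nt; apply/asboolP.
apply: (related_special c U c_odd c_gt1 cU U2 t' t (sol t' t'L) (sol t tL)).
- exact: related_sym (sol t tL) (sol t' t'L) rel.
- exact: ltnW.
- by rewrite eq_sym.
Qed.

Lemma sum_expn_card (m : nat) :
  (\sum_(V : {set 'I_m}) (2 ^ #|V| + 1) = 3 ^ m + 2 ^ m)%N.
Proof.
have gen k : (\sum_(V : {set 'I_m}) k ^ #|V| = k.+1 ^ m)%N.
  have := @bigA_distr nat 0%N 1%N muln addn 'I_m (fun=> k) (fun=> 1%N).
  rewrite prod_nat_const card_ord /= addn1 => ->; apply: eq_bigr => V _.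
  by rewrite -big_mkcond /= prod_nat_const.
rewrite big_split /= gen; congr (_ + _)%N; rewrite -(gen 1%N).
by apply: eq_bigr => V _; rewrite exp1n.
Qed.

Definition normalize (t : int * int * nat) : nat * nat * nat :=
  let: (A, B, z) := t in
  if odd `|A| then (`|B|%N, `|A|%N, z) else (`|A|%N, `|B|%N, z).

Section Assembly.
Variables (R : {fset nat}) (c : nat).
Hypotheses (R_prime : forall p : nat, p \in R -> prime p)
  (c_gt0 : (0 < c)%N) (c_odd : odd c)
  (c_R : forall p : nat, prime p -> (p %| c)%N -> p \notin R).

Lemma solutions_pos A B z : solutions R c (A, B, z) -> 0 < A /\ 0 < B.
Proof.
case=> -[AB_gt0 _] A_lt _ ABE; have : 0 < A + B by rewrite ABE ltz_nat expn_gt0 c_gt0.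
by clear -AB_gt0; nia.
Qed.

Lemma solutions_normalize t : solutions R c t ->
  let: (a, b, z) := normalize t in
  [/\ (1 < c)%N, solution c (primes (a * b)) (a, b, z), 2%N \in primes (a * b) &
     {subset primes (a * b) <= R}].
Proof.
case: t => [[A B] z] sol; have [A_gt0 B_gt0] := solutions_pos _ _ _ sol.
case: sol => -[_ supp] A_lt z_gt0; rewrite /normalize.
have AE : A = `|A|%N by rewrite gez0_abs // ltW.
have BE : B = `|B|%N by rewrite gez0_abs // ltW.
have a0 : (0 < `|A|)%N by rewrite absz_gt0 gt_eqF.
have b0 : (0 < `|B|)%N by rewrite absz_gt0 gt_eqF.
have suppN : {subset primes (`|A| * `|B|) <= R}.
  move=> p; rewrite mem_primes => /and3P[p_pr _ pAB].
  apply: contraTT pAB => pR; have := supp p p_pr pR.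
  by rewrite dvdzE abszM.
move: A_lt; rewrite AE BE; move: (`|A|%N) (`|B|%N) a0 b0 suppN => a b a0 b0 suppN.
clear -c_odd c_gt0 z_gt0 a0 b0 suppN.
rewrite ltz_nat -PoszD => a_lt [abE]; rewrite !absz_nat.
have c_gt1 : (1 < c)%N.
  rewrite ltn_neqAle c_gt0 andbT; apply/eqP => c1.
  by move: abE; rewrite -c1 exp1n; lia.
have ab_odd : odd (a + b) by rewrite abE oddX c_odd orbT.
have ab2 : 2%N \in primes (a * b).
  rewrite mem_primes muln_gt0 a0 b0 dvdn2 oddM /=.
  by move: ab_odd; rewrite oddD; case: (odd a); case: (odd b).
move: ab_odd; rewrite oddD; case: ifP => /= [a_odd|/negbT a_even] b_par.
  by split; rewrite // 1?mulnC // /solution a0 b0 z_gt0 b_par addnC abE !eqxx.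
by split; rewrite // /solution a0 b0 z_gt0 a_even abE !eqxx.
Qed.

Lemma normalize_inj : {in solutions R c &, injective normalize}.
Proof.
move=> [[A B] z] [[A' B'] z']; rewrite !inE => sol sol'.
have [A0 B0] := solutions_pos _ _ _ sol; have [A0' B0'] := solutions_pos _ _ _ sol'.
case: sol sol' => [_ lt _ _] [_ lt' _ _]; rewrite /normalize.
case: ifP => _; case: ifP => _ [e1 e2 ->]; congr (_, _, _); lia.
Qed.

(** The support of a solution is 2 together with a subset V of the m = |R| - 1 other
    primes of R, and each V contributes at most 2^|V| + 1 solutions. *)
Lemma solutions_seq_bound (L : seq (int * int * nat)) : uniq L ->
  {in L, forall t, solutions R c t} -> L <> [::] ->
  2%N \in R /\ (size L <= 3 ^ (#|` R|%fset).-1 + 2 ^ (#|` R|%fset).-1)%N.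
Proof.
move=> L_uniq sol L_neq0.
have c_gt1 : (1 < c)%N.
  case: (L) L_neq0 sol => // t L' _ /(_ t (mem_head _ _)) /solutions_normalize.
  by case: (normalize t) => [[a b] z] [].
have R2 : 2%N \in R.
  case: (L) L_neq0 sol => // t L' _ /(_ t (mem_head _ _)) /solutions_normalize.
  by case: (normalize t) => [[a b] z] [_ _ ab2]; apply.
split=> //.
pose T := [seq p <- enum_fset R | p != 2%N]; pose m := size T.
have T_uniq : uniq T by rewrite filter_uniq // fset_uniq.
have mE : m = (#|` R|%fset).-1.
  have := count_predC (pred1 2%N) (enum_fset R).
  by rewrite count_uniq_mem ?fset_uniq // R2 /m size_filter => <-.
rewrite -mE -sum_expn_card.
pose L1 := map normalize L.
have L1_uniq : uniq L1.
  rewrite map_inj_in_uniq // => t t' tL t'L; apply: normalize_inj; rewrite inE; exact: sol.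
have L1_sol a b z : (a, b, z) \in L1 -> [/\ solution c (primes (a * b)) (a, b, z),
    2%N \in primes (a * b) & {subset primes (a * b) <= R}].
  case/mapP => t tL abE; have := solutions_normalize _ (sol t tL).
  by rewrite -abE => -[].
pose supp (t : nat * nat * nat) := [set i : 'I_m | (nth 0%N T i %| t.1.1 * t.1.2)%N]%SET.
have -> : size L = size L1 by rewrite size_map.
rewrite -sum1_size (partition_big supp xpredT) //=; apply: leq_sum => V _.
rewrite sum1_count -size_filter.
have M_uniq : uniq [seq t <- L1 | supp t == V] by rewrite filter_uniq.
have M_sol t : t \in [seq t <- L1 | supp t == V] -> supp t = V /\ t \in L1.
  by rewrite mem_filter => /andP[/eqP].
move: {L1_uniq} [seq t <- L1 | supp t == V] M_uniq M_sol => M M_uniq M_sol.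
case: M => [//|[[a b] z] M'] in M_uniq M_sol *; set M := _ :: M' in M_uniq M_sol *.
have [suppV abL] := M_sol _ (mem_head _ _).
have index_T p : p \in R -> p != 2%N -> exists i : 'I_m, nth 0%N T i = p.
  move=> pR p2; have pT : p \in T by rewrite mem_filter p2.
  have lt : (index p T < m)%N by rewrite index_mem.
  by exists (Ordinal lt); rewrite /= nth_index.
have sub_primes t t' : supp t = supp t' -> 2%N \in primes (t'.1.1 * t'.1.2) ->
    {subset primes (t.1.1 * t.1.2) <= R} ->
    {subset primes (t.1.1 * t.1.2) <= primes (t'.1.1 * t'.1.2)}.
  move=> tt' t'2 tR p pt; have [->//|p2] := eqVneq p 2%N.
  have [i iE] := index_T p (tR p pt) p2.
  have : i \in supp t by rewrite inE iE; move: pt; rewrite mem_primes => /and3P[].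
  rewrite tt' inE iE => pt'; rewrite mem_primes pt'.
  move: pt t'2; rewrite !mem_primes => /and3P[-> _ _] /and3P[_ -> _] //.
have [sol0 ab2 abR] := L1_sol _ _ _ abL.
have mem_U a' b' z' : (a', b', z') \in M -> primes (a' * b') = primes (a * b).
  case/M_sol => suppV' abL'; have [_ ab2' abR'] := L1_sol _ _ _ abL'.
  apply/eq_primes => p; apply/idP/idP.
    by apply: (sub_primes (a', b', z') (a, b, z)) => //; rewrite suppV suppV'.
  by apply: (sub_primes (a, b, z) (a', b', z')) => //; rewrite suppV suppV'.
apply: (@leq_trans (2 ^ (size (primes (a * b))).-1 + 1)%N).
  apply: (@solutions_size c (primes (a * b))) => //.
    by move=> p pU; apply/negP => pc; move: (abR p pU); apply/negP; apply: c_R pc;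
      apply: R_prime (abR p pU).
  by move=> [[a' b'] z'] abM; rewrite -(mem_U _ _ _ abM);
    have [_ /L1_sol[]] := M_sol _ abM.
rewrite leq_add2r leq_exp2l //.
have sub : {subset primes (a * b) <= 2%N :: [seq nth 0%N T i | i : 'I_m <- enum V]}.
  move=> p pab; rewrite in_cons; have [//|p2] := eqVneq p 2%N.
  have [i iE] := index_T p (abR p pab) p2; apply/mapP; exists i => //.
  rewrite mem_enum -suppV inE iE.
  by move: pab; rewrite mem_primes => /and3P[].
have := uniq_leq_size (primes_uniq _) sub; rewrite /= size_map -cardE.
by case: (size _).
Qed.
End Assembly.

Theorem corollary2 (R : {fset nat}) (w c : nat)
  (R_prime : forall p : nat, p \in R -> prime p)
  (R_card : #|` R|%fset = w)
  (c_gt0 : (0 < c)%N) (c_odd : odd c)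
  (c_R : forall p : nat, prime p -> (p %| c)%N -> p \notin R) :
  finite_set (solutions R c) /\
  (#|` fset_set (solutions R c)|%fset)%:R
    <= (3%:Q ^ (w%:Z - 1) + 2%:Q ^ (w%:Z - 1))%R.
Proof.
have bound := solutions_seq_bound R c R_prime c_gt0 c_odd c_R.
have fin : finite_set (solutions R c).
  apply: contrapT => /(infinite_set_fset (3 ^ w.-1 + 2 ^ w.-1).+1)[B BS B_size].
  have [||_] := bound (enum_fset B) (fset_uniq B).
  - by move=> t tB; apply: BS.
  - by move=> B0; rewrite B0 in B_size.
  by rewrite R_card leqNgt B_size.
split=> //.
have mem t : t \in enum_fset (fset_set (solutions R c)) -> solutions R c t.
  by move=> tS; apply/set_mem; rewrite -in_fset_set.
have [S0|S_neq0] := eqVneq (enum_fset (fset_set (solutions R c))) [::].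
  by rewrite S0 /= addr_ge0 // exprz_ge0.
have [R2 le] := bound _ (fset_uniq _) mem (elimN eqP S_neq0).
have w_gt0 : (0 < w)%N by rewrite -R_card cardfs_gt0; apply/fset0Pn; exists 2%N.
have -> : w%:Z - 1 = w.-1 by lia.
by rewrite -!exprnP -!natrX -natrD ler_nat -R_card.
Qed.
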